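(* There exist an integer $d\ge2$ and $n_0$ such that the following holds for $G=\mathrm{SL}(2,q)$ with $n=|G|\ge n_0$. If $\mu_1,\dots,\mu_d$ are $(1/\sqrt n,2)$-good probability distributions on $G^3$, then $\mu_1*\cdots*\mu_d$ is $(1/n^2,3)$-good.
   Context: A distribution $D$ on $G^m$ is $(\epsilon,k)$-good if for any $1\le i_1<\dots<i_k\le m$ and any $g_1,\dots,g_k\in G$, the probability that $x_{i_j}=g_j$ for all $j$, when $x\sim D$, lies between $(1-\epsilon)n^{-k}$ and $(1+\epsilon)n^{-k}$, where $n=|G|$. The convolution $\mu*\nu$ of distributions on $G^m$ (coordinatewise group operation) is the distribution of $xy$ with $x\sim\mu$, $y\sim\nu$ independent. $\mathrm{SL}(2,q)$ is the group of $2\times2$ determinant-one matrices over $\mathbb F_q$. *)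

(* Defs.v *)
From HB Require Import structures.
From mathcomp Require Import all_boot all_order all_algebra all_fingroup all_field.
Set Implicit Arguments. Unset Strict Implicit. Unset Printing Implicit Defensive.
Import Order.TTheory GRing.Theory Num.Theory.

Definition SL2_set (F : finFieldType) : {set {'GL_2[F]}} :=
  [set x : {'GL_2[F]} | (\det (GLval x) == 1)%R].

Lemma SL2_group_set (F : finFieldType) : group_set (SL2_set F).
Proof.
apply/group_setP; split.
  by rewrite inE GL_1E det1.
move=> x y; rewrite !inE GL_MxE det_mulmx => /eqP-> /eqP->.
by rewrite mulr1.
Qed.

Canonical SL2_group (F : finFieldType) := Group (SL2_group_set F).

Definition SL2 (F : finFieldType) : finGroupType := subg_of (SL2_group F).

Local Open Scope ring_scope.

Section Dist.
Variables (gT : finGroupType) (R : numDomainType) (m : nat).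

Local Notation tupG := {ffun 'I_m -> gT}.

Definition tmul (x y : tupG) : tupG := [ffun i => (x i * y i)%g].

Definition is_prob_dist (D : {ffun tupG -> R}) : Prop :=
  (forall x, 0 <= D x) /\ \sum_x D x = 1.

Definition conv (mu nu : {ffun tupG -> R}) : {ffun tupG -> R} :=
  [ffun z => \sum_x \sum_y (if tmul x y == z then mu x * nu y else 0)].

Definition conv_seq (mus : seq {ffun tupG -> R}) : {ffun tupG -> R} :=
  match mus with
  | [::] => [ffun z => if z == [ffun _ => 1%g] then 1 else 0]
  | mu :: mus' => foldl conv mu mus'
  end.

Definition marg (D : {ffun tupG -> R}) (I : {set 'I_m}) (g : tupG) : R :=
  \sum_(x : tupG | [forall i in I, x i == g i]) D x.

Definition good (eps : R) (k : nat) (D : {ffun tupG -> R}) : Prop :=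
  forall (I : {set 'I_m}) (g : tupG), #|I| = k ->
    (1 - eps) / (#|gT|%:R ^+ k) <= marg D I g /\
    marg D I g <= (1 + eps) / (#|gT|%:R ^+ k).

End Dist.

Notation tupG gT m := {ffun 'I_m -> FinGroup.sort gT}.

(* Main.v *)
Require Import Defs.
From HB Require Import structures.
From mathcomp Require Import all_boot all_order all_algebra all_fingroup all_field.
From mathcomp Require Import zify ring lra.
Import Order.TTheory GRing.Theory Num.Theory.
Local Open Scope ring_scope.
Set Implicit Arguments. Unset Strict Implicit. Unset Printing Implicit Defensive.

(** Write [T] for the sum of [mu x] times left translation by [x], acting on the
    functions on [G^3].  It suffices that [T] contracts the functions orthogonal
    to the constants by a fixed negative power of [q], since convolving many
    measures then gains any prescribed power of [n].  On functions that do not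
    depend on some coordinate this is pairwise goodness.  On functions with mean
    zero in every coordinate, Cauchy-Schwarz bounds [P = T^T T] from above by the
    operator [K0] of the random element [(1, y^-1 y', z^-1 z')] obtained from two
    samples with the same first coordinate, and likewise by the operator [K1] of
    [(x^-1 x', 1, z^-1 z')].  Hence [tr P^4 <= tr K0 K1 K0 K1], and the latter
    counts coincidences [w v = v' w'] in the third coordinate: these are rare
    because few elements of [SL(2,q)] intertwine two given noncentral elements.
    Finally [P^4] commutes with right translations, so quasirandomness bounds its
    norm on these functions by [O(q^-3) tr P^4 + O(q^-1)].  Over a real closed field this is
    done without characters, by summing over the translates of a function under
    the upper triangular subgroup. *)

(** * Inner product and operator bounds *)

(** Noncommutativity has to enter: in an abelian group the uniform distribution on the triples (x,
    y, x y) has perfectly uniform pairs, yet all its convolution powers stay on that subgroup. For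
    the same distribution on SL(2,q) the trace of P is n, of the order of the q^3 supplied by
    quasirandomness, so a plain trace estimate gains nothing. The majorants K0 and K1 are alternated
    because K0 leaves the first coordinate alone and K1 the second: in a product of the two only the
    third coordinate carries two factors, and the trace compares these in opposite orders. The
    intertwiner count then gives tr P^4 = O(q^(5/2)), half a power below q^3, and this surplus is
    the gain. Extracting it costs roots: off the constants the squared norm of T is only
    O(q^(-1/8)), and convolving 480 measures pays for the roots and for all constants. *)

HB.lock Definition dot (R : rcfType) (N : nat) (u v : 'cV[R]_N) : R :=
  \sum_i u i 0 * v i 0.

Section Dot.
Variables (R : rcfType) (N : nat).
Implicit Types (u v w : 'cV[R]_N) (A B C : 'M[R]_N).

Definition nrm u : R := dot u u.

Lemma dotE u v : dot u v = (u^T *m v) 0 0.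
Proof. by rewrite unlock mxE; apply: eq_bigr => i _; rewrite mxE. Qed.

Lemma dotC u v : dot u v = dot v u.
Proof. by rewrite unlock; apply: eq_bigr => i _; rewrite mulrC. Qed.

Lemma dotDl u v w : dot (u + v) w = dot u w + dot v w.
Proof. by rewrite unlock -big_split; apply: eq_bigr => i _; rewrite mxE mulrDl. Qed.

Lemma dotDr u v w : dot w (u + v) = dot w u + dot w v.
Proof. by rewrite dotC dotDl !(dotC _ w). Qed.

Lemma dotZl a u v : dot (a *: u) v = a * dot u v.
Proof. by rewrite unlock mulr_sumr; apply: eq_bigr => i _; rewrite mxE mulrA. Qed.

Lemma dotZr a u v : dot u (a *: v) = a * dot u v.
Proof. by rewrite dotC dotZl dotC. Qed.

Lemma dotNl u v : dot (- u) v = - dot u v.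
Proof. by rewrite -scaleN1r dotZl mulN1r. Qed.

Lemma dotNr u v : dot u (- v) = - dot u v.
Proof. by rewrite dotC dotNl dotC. Qed.

Lemma dot0l u : dot 0 u = 0.
Proof. by rewrite -(scale0r 0) dotZl mul0r. Qed.

Lemma dot0r u : dot u 0 = 0.
Proof. by rewrite dotC dot0l. Qed.

Lemma dot_suml (I : Type) (r : seq I) (P : pred I) (f : I -> 'cV[R]_N) v :
  dot (\sum_(i <- r | P i) f i) v = \sum_(i <- r | P i) dot (f i) v.
Proof.
elim/big_rec2: _ => [|i y x _ <-]; first exact: dot0l.
exact: dotDl.
Qed.

Lemma dot_sumr (I : Type) (r : seq I) (P : pred I) (f : I -> 'cV[R]_N) v :
  dot v (\sum_(i <- r | P i) f i) = \sum_(i <- r | P i) dot v (f i).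
Proof. by rewrite dotC dot_suml; apply: eq_bigr => i _; rewrite dotC. Qed.

Lemma dot_mull A u v : dot (A *m u) v = dot u (A^T *m v).
Proof. by rewrite !dotE trmx_mul mulmxA. Qed.

Lemma dot_mulr A u v : dot u (A *m v) = dot (A^T *m u) v.
Proof. by rewrite dotC dot_mull dotC. Qed.

Lemma nrm_ge0 u : 0 <= nrm u.
Proof. by rewrite /nrm unlock; apply: sumr_ge0 => i _; rewrite -expr2 sqr_ge0. Qed.

Lemma nrm0 : nrm 0 = 0. Proof. exact: dot0l. Qed.

Lemma nrmN u : nrm (- u) = nrm u.
Proof. by rewrite /nrm dotNl dotNr opprK. Qed.

Lemma nrmZ a u : nrm (a *: u) = a ^+ 2 * nrm u.
Proof. by rewrite /nrm dotZl dotZr mulrA expr2. Qed.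

Lemma nrm_eq0 u : nrm u = 0 -> u = 0.
Proof.
move=> /eqP; rewrite /nrm unlock psumr_eq0; last by move=> i _; rewrite -expr2 sqr_ge0.
move=> /allP h; apply/matrixP=> i j; rewrite ord1 mxE.
by have := h i (mem_index_enum _); rewrite -expr2 sqrf_eq0 => /eqP.
Qed.

Lemma nrmD u v : nrm (u + v) = nrm u + nrm v + 2 * dot u v.
Proof. by rewrite /nrm dotDl !dotDr (dotC v u); ring. Qed.

Lemma nrmD_orth u v : dot u v = 0 -> nrm (u + v) = nrm u + nrm v.
Proof. by move=> h; rewrite nrmD h mulr0 addr0. Qed.

Lemma nrmD_le u v : nrm (u + v) <= 2 * (nrm u + nrm v).
Proof.
have := nrm_ge0 (u - v); rewrite !nrmD nrmN dotNr mulrN subr_ge0 => h.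
by rewrite [leRHS]mulr_natl mulr2n lerD2l.
Qed.

Lemma dot_le u v : 2 * dot u v <= nrm u + nrm v.
Proof. by have := nrm_ge0 (u - v); rewrite nrmD nrmN dotNr mulrN subr_ge0. Qed.

Lemma dot_sqr_le u v : (dot u v) ^+ 2 <= nrm u * nrm v.
Proof.
have [v0|vn0] := eqVneq (nrm v) 0.
  by rewrite (nrm_eq0 v0) dot0r nrm0 expr0n mulr0.
have vp : 0 < nrm v by rewrite lt0r vn0 nrm_ge0.
have := nrm_ge0 (nrm v *: u - dot u v *: v).
rewrite nrmD nrmN !nrmZ dotNr dotZl dotZr mulrN => h.
have {h}: 0 <= nrm v * (nrm u * nrm v - dot u v ^+ 2).
  by apply: le_trans h _; rewrite le_eqVlt; apply/orP; left; apply/eqP; ring.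
by rewrite pmulr_rge0 // subr_ge0.
Qed.

(* [c] bounds the square of the operator norm. *)
Definition opn (c : R) A := forall u, nrm (A *m u) <= c * nrm u.

End Dot.

Section OpNorm.
Variables (R : rcfType) (N : nat).
Implicit Types (u v w : 'cV[R]_N) (A B C U : 'M[R]_N).

Lemma opn_le c d A : c <= d -> opn c A -> opn d A.
Proof. by move=> cd h u; apply: le_trans (h u) _; rewrite ler_wpM2r ?nrm_ge0. Qed.

Lemma opn_mul c d A B : 0 <= c -> opn c A -> opn d B -> opn (c * d) (A *m B).
Proof.
move=> c0 hA hB u; rewrite -mulmxA; apply: le_trans (hA _) _.
by rewrite -mulrA ler_wpM2l.
Qed.

Lemma opn1_mul A B : opn 1 A -> opn 1 B -> opn 1 (A *m B).
Proof. by move=> hA hB; have := opn_mul ler01 hA hB; rewrite mulr1. Qed.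

Lemma opn_add c d A B : opn c A -> opn d B -> opn (2 * (c + d)) (A + B).
Proof.
move=> hA hB u; rewrite mulmxDl; apply: le_trans (nrmD_le _ _) _.
by rewrite -mulrA ler_wpM2l // mulrDl lerD.
Qed.

Lemma opn_isom U : U^T *m U = 1%:M -> forall u, nrm (U *m u) = nrm u.
Proof. by move=> h u; rewrite /nrm dot_mull mulmxA h mul1mx. Qed.

Lemma opn_wsum (I : finType) (w : I -> R) (U : I -> 'M[R]_N) :
  (forall i, opn 1 (U i)) -> opn ((\sum_i `|w i|) ^+ 2) (\sum_i w i *: U i).
Proof.
move=> hU u; rewrite mulmx_suml /nrm dot_suml expr2 !mulr_suml.
apply: ler_sum => i _; rewrite dot_sumr mulr_sumr mulr_suml.
apply: ler_sum => j _; rewrite -!scalemxAl dotZl dotZr mulrA.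
apply: le_trans (ler_norm _) _; rewrite !normrM ler_wpM2l ?mulr_ge0 //.
have h := dot_sqr_le (U i *m u) (U j *m u).
have hi := hU i u; have hj := hU j u; rewrite !mul1r in hi hj.
rewrite -(@ler_pXn2r _ 2) ?nnegrE ?nrm_ge0 // real_normK ?num_real //.
by apply: le_trans h _; rewrite expr2 ler_pM ?nrm_ge0.
Qed.

Lemma nrm_sum_le (I : finType) (f : I -> 'cV[R]_N) :
  nrm (\sum_i f i) <= #|I|%:R * \sum_i nrm (f i).
Proof.
rewrite -(ler_pM2l (ltr0n R 2)) /nrm dot_suml mulr_sumr.
rewrite [leRHS](_ : _ = \sum_i \sum_j (nrm (f i) + nrm (f j))).
  apply: ler_sum => i _; rewrite dot_sumr mulr_sumr.
  by apply: ler_sum => j _; exact: dot_le.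
under [RHS]eq_bigr do rewrite big_split /= sumr_const.
by rewrite big_split /= sumr_const sumrMnl [LHS]mulr_natl mulr2n mulr_natl.
Qed.

Lemma opn_tr A : opn 1 A -> opn 1 A^T.
Proof.
move=> h u; rewrite mul1r.
have := dot_sqr_le (A *m (A^T *m u)) u.
rewrite dot_mull -/(nrm _) => hc.
have [->|n0] := eqVneq (nrm (A^T *m u)) 0; first exact: nrm_ge0.
have np : 0 < nrm (A^T *m u) by rewrite lt0r n0 nrm_ge0.
rewrite -(ler_pM2l np) -expr2; apply: le_trans hc _.
by rewrite ler_wpM2r ?nrm_ge0 //; have := h (A^T *m u); rewrite mul1r.
Qed.

(** Only the quadratic form matters; no symmetry of [A] is asked. *)
Definition psdq A := forall u, 0 <= dot u (A *m u).

Lemma trace_conj A C : \tr (C *m A *m C^T) =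
  \sum_i dot (row i C)^T (A *m (row i C)^T).
Proof.
apply: eq_bigr => i _; rewrite dotE trmxK mulmxA -row_mul !mxE.
by apply: eq_bigr => j _; rewrite !mxE.
Qed.

Lemma trace_psdq A C : psdq A -> 0 <= \tr (A *m (C^T *m C)).
Proof.
by move=> h; rewrite mulmxA mxtrace_mulC mulmxA trace_conj sumr_ge0.
Qed.

Lemma trace_mulT C : \tr (C *m C^T) = \sum_i nrm (row i C)^T.
Proof.
have := trace_conj 1%:M C; rewrite mulmx1 => ->.
by apply: eq_bigr => i _; rewrite mul1mx.
Qed.

Lemma trace_ge0 C : 0 <= \tr (C *m C^T).
Proof. by rewrite trace_mulT sumr_ge0 // => i _; exact: nrm_ge0. Qed.

End OpNorm.

(** * Orthogonal representations and their averages *)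

Section Average.
Variables (R : rcfType) (N : nat) (G : finGroupType).

Record orep (rho : G -> 'M[R]_N) : Prop := Orep {
  orepM : forall x y, rho (x * y)%g = rho x *m rho y;
  orepV : forall x, (rho x)^T = rho x^-1%g;
  orep1 : rho 1%g = 1%:M }.

(** For an orthogonal representation this is the orthogonal projection onto the invariant
    vectors. *)
Definition avg (rho : G -> 'M[R]_N) : 'M[R]_N := #|G|%:R^-1 *: \sum_x rho x.

Variable rho : G -> 'M[R]_N.
Hypothesis rhoP : orep rho.

Lemma orep_isom x : (rho x)^T *m rho x = 1%:M.
Proof. by rewrite (orepV rhoP) -(orepM rhoP) mulVg (orep1 rhoP). Qed.

Lemma nrm_orep x u : nrm (rho x *m u) = nrm u.
Proof. exact: opn_isom (orep_isom x) u. Qed.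

Lemma opn_orep x : opn 1 (rho x).
Proof. by move=> u; rewrite nrm_orep mul1r. Qed.

Lemma mul_avg x : rho x *m avg rho = avg rho.
Proof.
rewrite /avg -scalemxAr mulmx_sumr; congr (_ *: _).
rewrite [RHS](reindex_inj (mulgI x)); apply: eq_bigr => y _.
by rewrite (orepM rhoP).
Qed.

Lemma cardG_neq0 : #|G|%:R != 0 :> R.
Proof. by rewrite pnatr_eq0 -lt0n; apply/card_gt0P; exists 1%g. Qed.

Lemma avg_idem : avg rho *m avg rho = avg rho.
Proof.
rewrite {1}/avg -scalemxAl mulmx_suml.
under eq_bigr do rewrite mul_avg.
by rewrite sumr_const -scaler_nat scalerA mulVf ?scale1r ?cardG_neq0.
Qed.

Lemma avg_tr : (avg rho)^T = avg rho.
Proof.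
rewrite /avg linearZ /= linear_sum /= (reindex_inj invg_inj); congr (_ *: _).
by apply: eq_bigr => x _; rewrite (orepV rhoP) invgK.
Qed.

End Average.

Section Proj.
Variables (R : rcfType) (N : nat).

Definition proj (e : 'M[R]_N) := e *m e = e /\ e^T = e.

Lemma proj_orth e u v : proj e -> dot (e *m u) ((1%:M - e) *m v) = 0.
Proof.
case=> [h1 h2]; rewrite dot_mull h2 mulmxA mulmxBr mulmx1 h1 subrr mul0mx.
exact: dot0r.
Qed.

Lemma proj_nrm e u : proj e -> nrm u = nrm (e *m u) + nrm ((1%:M - e) *m u).
Proof.
move=> h; rewrite -nrmD_orth ?proj_orth //.
by rewrite -mulmxDl addrC subrK mul1mx.
Qed.

Lemma projC e : proj e -> proj (1%:M - e).
Proof.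
case=> h1 h2; split; last by rewrite linearB /= h2 trmx1.
by rewrite mulmxBr mulmx1 mulmxBl mul1mx h1 subrr subr0.
Qed.

Lemma opn_proj e : proj e -> opn 1 e.
Proof. by move=> h u; rewrite mul1r (proj_nrm u h) lerDl nrm_ge0. Qed.

Lemma proj_avg (G : finGroupType) (rho : G -> 'M[R]_N) :
  orep rho -> proj (avg rho).
Proof. by move=> h; split; [exact: avg_idem | exact: avg_tr]. Qed.

Lemma comm_avg (G : finGroupType) (rho : G -> 'M[R]_N) A :
  (forall x, rho x *m A = A *m rho x) -> avg rho *m A = A *m avg rho.
Proof.
move=> h; rewrite /avg -scalemxAl -scalemxAr mulmx_suml mulmx_sumr.
by congr (_ *: _); apply: eq_bigr => x _.
Qed.

End Proj.

(** * Positive definite functions and the torus action *)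

Section Gram.
Variables (R : rcfType) (N : nat).

(** An entrywise product of two Gram matrices, summed over all entries, is a Hilbert-Schmidt inner
    product of sums of rank-one matrices. Positivity and Cauchy-Schwarz for such products thus
    reduce to the trace of a matrix times its transpose. *)
Lemma trace_outer (I J : finType) (a b : I -> 'cV[R]_N) (c d : J -> 'cV[R]_N) :
  \tr ((\sum_i a i *m (b i)^T) ^T *m (\sum_j c j *m (d j)^T)) =
  \sum_i \sum_j dot (a i) (c j) * dot (b i) (d j).
Proof.
rewrite [X in X *m _]linear_sum mulmx_suml linear_sum; apply: eq_bigr => i _.
rewrite mulmx_sumr linear_sum; apply: eq_bigr => j _ /=.
rewrite trmx_mul trmxK mulmxA -(mulmxA (b i)) [(a i)^T *m _]mx11_scalar -dotE.
rewrite mul_mx_scalar -scalemxAl linearZ /= mxtrace_mulC; congr (_ * _).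
by rewrite dotC dotE [_ *m b i]mx11_scalar mxtrace_scalar !mxE.
Qed.

Lemma gram_ge0 (I : finType) (a b : I -> 'cV[R]_N) :
  0 <= \sum_i \sum_j dot (a i) (a j) * dot (b i) (b j).
Proof.
by rewrite -trace_outer; have := trace_ge0 (\sum_i a i *m (b i)^T)^T; rewrite trmxK.
Qed.

Lemma gram_le (I : finType) (a b c d : I -> 'cV[R]_N) :
  2 * (\sum_i \sum_j dot (a i) (c j) * dot (b i) (d j)) <=
  \sum_i \sum_j dot (a i) (a j) * dot (b i) (b j) +
  \sum_i \sum_j dot (c i) (c j) * dot (d i) (d j).
Proof.
rewrite -!trace_outer; set A := \sum_i a i *m _; set B := \sum_i c i *m _.
have := trace_ge0 ((A - B)^T); rewrite trmxK mulmxBr [(A - B)^T]linearB !mulmxBl.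
rewrite !linearB /= -[\tr (B^T *m A)]mxtrace_tr trmx_mul trmxK.
lra.
Qed.

Variable V : finGroupType.
Hypothesis mulVC : commutative (@mulg V).
Variables rho sig : V -> 'M[R]_N.
Hypotheses (rhoP : orep rho) (sigP : orep sig).

Lemma dot_orep2 (r : V -> 'M[R]_N) (rP : orep r) u v f g :
  dot (r u *m f) (r v *m g) = dot f (r (u^-1 * v)%g *m g).
Proof. by rewrite dot_mull (orepV rP) mulmxA -(orepM rP). Qed.

Lemma dot_orepV (r : V -> 'M[R]_N) (rP : orep r) u f g :
  dot f (r u^-1%g *m g) = dot g (r u *m f).
Proof. by rewrite dotC dot_mull (orepV rP) invgK. Qed.

Lemma dot_orepV2 (r : V -> 'M[R]_N) (rP : orep r) u v f g :
  dot (r u^-1%g *m f) (r v^-1%g *m g) = dot g (r (u^-1 * v)%g *m f).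
Proof. by rewrite dot_orep2 // -invMg mulVC dot_orepV // mulVC. Qed.

Lemma sum_diff (h : V -> R) :
  \sum_u \sum_v h (u^-1 * v)%g = #|V|%:R * \sum_w h w.
Proof.
rewrite (eq_bigr (fun=> \sum_w h w)) => [|u _].
  by rewrite sumr_const mulr_natl.
by rewrite [RHS](reindex_inj (mulgI u^-1%g)).
Qed.

Lemma cardV_gt0 : 0 < #|V|%:R :> R.
Proof. by rewrite ltr0n; apply/card_gt0P; exists 1%g. Qed.

(** Schur's product theorem for two positive definite functions on [V]: the Gram sum over pairs
    depends only on [u^-1 * v], hence is [#|V|] times this single sum. *)
Lemma posdef_mul_ge0 f g :
  0 <= \sum_u dot g (rho u *m g) * dot f (sig u *m f).
Proof.
have := gram_ge0 (fun u => rho u *m g) (fun u => sig u *m f).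
under eq_bigr do under eq_bigr do rewrite !dot_orep2 //.
rewrite (sum_diff (fun w => dot g (rho w *m g) * dot f (sig w *m f))).
by rewrite pmulr_rge0 // cardV_gt0.
Qed.

(* Over the complex numbers this is Cauchy-Schwarz on each character of [V]. *)
Lemma matcoef_sqr_le f g :
  \sum_u (dot g (rho u *m f)) ^+ 2 <=
  \sum_u dot g (rho u *m g) * dot f (rho u *m f).
Proof.
have := gram_le (fun u => rho u *m g) (fun u => rho u^-1%g *m f)
                (fun u => rho u *m f) (fun u => rho u^-1%g *m g).
under eq_bigr do under eq_bigr do rewrite dot_orepV2 // dot_orep2 // -expr2.
rewrite (sum_diff (fun w => dot g (rho w *m f) ^+ 2)).
under [X in X + _]eq_bigr do under eq_bigr do rewrite dot_orepV2 // dot_orep2 //.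
rewrite (sum_diff (fun w => dot g (rho w *m g) * dot f (rho w *m f))).
under [X in _ + X]eq_bigr do under eq_bigr do
  rewrite dot_orepV2 // dot_orep2 // mulrC.
rewrite (sum_diff (fun w => dot g (rho w *m g) * dot f (rho w *m f))).
by have := cardV_gt0; nra.
Qed.

End Gram.

(** * Dilations of the additive group *)

Section Dilation.
Variables (R : rcfType) (F : finFieldType).
Local Notation q := (#|F|%:R : R).

(** The sum of all nontrivial additive characters of [F] at [x], written without characters. *)
Definition ramanujan (x : F) : R := q * (x == 0)%:R - 1.

Lemma sum_dilate (psi : F -> R) x : \sum_y psi y = 0 ->
  \sum_(c | c != 0) psi (c * x) = ramanujan x * psi 0.
Proof.
move=> h; rewrite /ramanujan; have [->|x0] := eqVneq x 0.
  under eq_bigr do rewrite mulr0.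
  rewrite sumr_const mulr1 -[LHS]mulr_natl; congr (_ * _).
  rewrite -(cardC (pred1 (0 : F))) card1 natrD addrAC subrr add0r.
  by congr _%:R; apply: eq_card => c; rewrite !inE.
rewrite mulr0 sub0r mulN1r; move: h; rewrite (bigD1 0) //= => /eqP.
rewrite addrC addr_eq0 => /eqP <-.
rewrite [RHS](reindex_inj (mulIf x0)) /=; apply: eq_bigl => c.
by rewrite mulf_eq0 (negPf x0) orbF.
Qed.

Lemma sum_sqr_le (h : F -> R) : (forall c, 0 <= h c) ->
  \sum_(s | s != 0) h (s ^+ 2) <= 2 * \sum_(c | c != 0) h c.
Proof.
move=> h0; rewrite (partition_big (fun s => s ^+ 2) (fun c => c != 0)) /=; last first.
  by move=> s; rewrite expf_eq0.
rewrite mulr_sumr; apply: ler_sum => c _.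
rewrite (eq_bigr (fun=> h c)); last by move=> s /andP[_ /eqP->].
rewrite sumr_const -[leLHS]mulr_natl ler_wpM2r // ler_nat.
case: (pickP [pred s : F | (s != 0) && (s ^+ 2 == c)]) => [s0 /andP[_ /eqP hs0]|hn].
  apply: leq_trans (_ : #|[:: s0; - s0]| <= 2)%N; last exact: card_size.
  apply: subset_leq_card; apply/subsetP => s; rewrite !inE => /andP[_].
  by rewrite -hs0 eqf_sqr.
by rewrite eq_card0 // => s; rewrite !inE; have := hn s.
Qed.

End Dilation.

Lemma sum_triple (R : zmodType) (A B C : finType) (h : A * B * C -> R) :
  \sum_v h v = \sum_x \sum_y \sum_z h (x, y, z).
Proof.
rewrite pair_bigA /= pair_bigA /=.
by apply: eq_bigr => -[[x y] z] _.
Qed.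

Lemma mulmxCA (R : comRingType) (N p : nat) (A B : 'M[R]_N) (X : 'M[R]_(N, p)) :
  A *m B = B *m A -> A *m (B *m X) = B *m (A *m X).
Proof. by move=> h; rewrite !mulmxA h. Qed.

Section Torus.
Variables (R : rcfType) (N : nat) (F : finFieldType).
Local Notation q := (#|F|%:R : R).
Variables (rho0 rho1 rho2 : F -> 'M[R]_N).
Hypotheses (rho0P : orep rho0) (rho1P : orep rho1) (rho2P : orep rho2).
Hypothesis c01 : forall x y, rho0 x *m rho1 y = rho1 y *m rho0 x.
Hypothesis c02 : forall x y, rho0 x *m rho2 y = rho2 y *m rho0 x.
Hypothesis c12 : forall x y, rho1 x *m rho2 y = rho2 y *m rho1 x.

Definition rho3 (v : F * F * F) := rho0 v.1.1 *m rho1 v.1.2 *m rho2 v.2.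

(** Makes every dilated coefficient of [f] positive definite. Zero dilations are included because
    [sum_sqr_le] asks for positivity at every point. *)
Lemma rho3_dilP (a b c : F) :
  orep (fun v : F * F * F => rho3 (a * v.1.1, b * v.1.2, c * v.2)).
Proof.
split=> [x y|x|] /=; rewrite /rho3 /=.
- rewrite !mulrDr -!FinRing.zmodMgE (orepM rho0P) (orepM rho1P) (orepM rho2P).
  rewrite -!mulmxA; congr (_ *m _).
  by rewrite -(mulmxCA _ (c02 _ _)) -(mulmxCA _ (c01 _ _)) -(mulmxCA _ (c12 _ _)).
- rewrite !trmx_mul (orepV rho0P) (orepV rho1P) (orepV rho2P).
  rewrite !FinRing.zmodVgE /= !mulrN.
  by rewrite -c01 -(mulmxCA _ (c02 _ _)) -c12 mulmxA.
- have e0 : 1%g = 0 :> F by [].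
  by rewrite !mulr0 -e0 (orep1 rho0P) (orep1 rho1P) (orep1 rho2P) !mul1mx.
Qed.

Lemma rho3P : orep rho3.
Proof.
have h := rho3_dilP 1 1 1.
have e v : rho3 (1 * v.1.1, 1 * v.1.2, 1 * v.2) = rho3 v.
  by rewrite /rho3 /= !mul1r.
split=> [x y|x|].
- by have := orepM h x y; rewrite !e.
- by have := orepV h x; rewrite !e.
- by have := orep1 h; rewrite !e.
Qed.

Lemma sum_ramanujan (r : F -> 'M[R]_N) (rP : orep r) :
  \sum_x ramanujan R x *: r x = q *: (1%:M - avg r).
Proof.
under eq_bigr do rewrite /ramanujan scalerBl scale1r.
rewrite big_split /= sumrN scalerBr; congr (_ - _); last first.
  by rewrite /avg scalerA divff ?scale1r // (cardG_neq0 R F).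
rewrite (bigD1 0) //= eqxx mulr1 big1 ?addr0 => [|x /negPf->].
  by rewrite (orep1 rP : r 0 = _).
by rewrite mulr0 scale0r.
Qed.

Variable f : 'cV[R]_N.
Hypotheses (f0 : avg rho0 *m f = 0) (f1 : avg rho1 *m f = 0)
           (f2 : avg rho2 *m f = 0).

Let phi x y z := dot f (rho3 (x, y, z) *m f).

Lemma avg_eq0 (r : F -> 'M[R]_N) (u : 'cV[R]_N) : avg r *m u = 0 -> \sum_x r x *m u = 0.
Proof.
rewrite /avg -scalemxAl mulmx_suml => /eqP; rewrite scaler_eq0 invr_eq0.
by rewrite (negPf (cardG_neq0 R F)) => /eqP.
Qed.

Let phi_sum0 y z : \sum_x phi x y z = 0.
Proof.
rewrite -dot_sumr /rho3 /= (eq_bigr (fun x => rho1 y *m rho2 z *m (rho0 x *m f))).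
  by rewrite -mulmx_sumr avg_eq0 // mulmx0 dot0r.
by move=> x _; rewrite -!mulmxA (mulmxCA _ (c01 _ _)) (mulmxCA _ (c02 _ _)).
Qed.

Let phi_sum1 x z : \sum_y phi x y z = 0.
Proof.
rewrite -dot_sumr /rho3 /= (eq_bigr (fun y => rho0 x *m rho2 z *m (rho1 y *m f))).
  by rewrite -mulmx_sumr avg_eq0 // mulmx0 dot0r.
by move=> y _; rewrite -!mulmxA (mulmxCA _ (c12 _ _)).
Qed.

Let phi_sum2 x y : \sum_z phi x y z = 0.
Proof.
rewrite -dot_sumr /rho3 /= (eq_bigr (fun z => rho0 x *m rho1 y *m (rho2 z *m f))).
  by rewrite -mulmx_sumr avg_eq0 // mulmx0 dot0r.
by move=> z _; rewrite !mulmxA.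
Qed.

(** As [f] has no fixed part in any coordinate, [phi] sums to zero along each coordinate line, so
    [sum_dilate] applies one coordinate at a time. *)
Lemma phi_dilate x y z :
  \sum_(a | a != 0) \sum_(b | b != 0) \sum_(c | c != 0)
     phi (a * x) (b * y) (c * z) = ramanujan R x * ramanujan R y * ramanujan R z * nrm f.
Proof.
under eq_bigr do under eq_bigr do rewrite (sum_dilate _ (phi_sum2 _ _)).
under eq_bigr do rewrite -mulr_sumr
  (sum_dilate (psi := fun y => phi _ y 0) _ (phi_sum1 _ _)).
rewrite -mulr_sumr -mulr_sumr (sum_dilate (psi := fun x => phi x 0 0) _ (phi_sum0 _ _)).
rewrite /phi (orep1 rho3P : rho3 (0,0,0) = _) mul1mx /nrm; ring.
Qed.

Lemma dot_opn1 (A : 'M[R]_N) g : opn 1 A -> dot g (A *m g) <= nrm g.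
Proof.
move=> hA; have := dot_le g (A *m g); have := hA g; lra.
Qed.

(** Weighting a representation by [ramanujan] and summing gives [q] times the projection away from
    its fixed vectors; three such projections make a contraction. *)
Lemma matcoef_ramanujan g :
  \sum_x \sum_y \sum_z dot g (rho3 (x, y, z) *m g) * (ramanujan R x * ramanujan R y * ramanujan R z)
  <= q ^+ 3 * nrm g.
Proof.
rewrite [leLHS](_ : _ = dot g ((\sum_x ramanujan R x *: rho0 x) *m
  (\sum_y ramanujan R y *: rho1 y) *m (\sum_z ramanujan R z *: rho2 z) *m g)); last first.
  rewrite 3!mulmx_suml dot_sumr; apply: eq_bigr => x _.
  rewrite [X in X *m _ *m g]mulmx_sumr 2!mulmx_suml dot_sumr; apply: eq_bigr => y _.
  rewrite mulmx_sumr mulmx_suml dot_sumr; apply: eq_bigr => z _.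
  rewrite -!scalemxAl -!scalemxAr -!scalemxAl !dotZr /rho3 /=; ring.
rewrite !sum_ramanujan // -!scalemxAl -!scalemxAr -!scalemxAl !dotZr.
rewrite exprS expr2 -!mulrA.
do 3 (rewrite ler_wpM2l ?ler0n //).
apply: dot_opn1.
have h (r : F -> 'M[R]_N) : orep r -> opn 1 (1%:M - avg r).
  by move=> rP; apply: opn_proj; apply: projC; exact: proj_avg.
exact: opn1_mul (opn1_mul (h _ rho0P) (h _ rho1P)) (h _ rho2P).
Qed.

Lemma mulF3C : commutative (@mulg ((F * F * F)%type : finGroupType)).
Proof.
by move=> [[a b] c] [[a' b'] c']; congr (_, _, _); exact: addrC.
Qed.

(** Models the diagonal torus, which conjugates upper unipotents through squares; only its effect on
    diagonal matrix coefficients is used. *)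
Variable theta : F -> F -> F -> 'M[R]_N.
Hypothesis thetaP : forall a b c, a != 0 -> b != 0 -> c != 0 -> forall x y z u,
  dot (theta a b c *m u) (rho3 (x, y, z) *m (theta a b c *m u)) =
  dot u (rho3 (a ^+ 2 * x, b ^+ 2 * y, c ^+ 2 * z) *m u).

(** A Bessel inequality for the translates of [f] under torus and unipotents. [matcoef_sqr_le]
    splits each sum over unipotents into a coefficient of [g] times a dilated coefficient of [f].
    Summing over the dilations collapses the latter to [ramanujan] weights. *)
Lemma torus_matcoef_sqr_le g :
  \sum_(a | a != 0) \sum_(b | b != 0) \sum_(c | c != 0) \sum_v
     dot g (rho3 v *m (theta a b c *m f)) ^+ 2 <= 8 * q ^+ 3 * nrm f * nrm g.
Proof.
pose h a b c := \sum_v dot g (rho3 v *m g) * phi (a * v.1.1) (b * v.1.2) (c * v.2).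
(* Positivity permits passing from square dilations to all of them: squaring is at most two-to-one
   in each coordinate, whence 8 = 2^3. *)
have h0 a b c : 0 <= h a b c.
  exact: (posdef_mul_ge0 rho3P (rho3_dilP a b c) f g).
have hle a b c : a != 0 -> b != 0 -> c != 0 ->
    \sum_v dot g (rho3 v *m (theta a b c *m f)) ^+ 2 <= h (a ^+ 2) (b ^+ 2) (c ^+ 2).
  move=> a0 b0 c0; apply: le_trans (matcoef_sqr_le mulF3C rho3P _ _) _.
  apply: ler_sum => -[[x y] z] _ /=; rewrite thetaP //.
apply: le_trans (_ : \sum_(a | a != 0) \sum_(b | b != 0) \sum_(c | c != 0)
   h (a ^+ 2) (b ^+ 2) (c ^+ 2) <= _).
  by apply: ler_sum => a a0; apply: ler_sum => b b0; apply: ler_sum => c c0; exact: hle.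
apply: le_trans (_ : 8 * \sum_(a | a != 0) \sum_(b | b != 0) \sum_(c | c != 0) h a b c <= _).
  apply: le_trans (sum_sqr_le (h := fun a' => \sum_(b | b != 0) \sum_(c | c != 0)
      h a' (b ^+ 2) (c ^+ 2)) _) _.
    by move=> a; apply: sumr_ge0 => b _; apply: sumr_ge0 => c _.
  rewrite (_ : 8 = 2 * 4); last by ring.
  rewrite -mulrA ler_wpM2l // [leRHS]mulr_sumr; apply: ler_sum => a _.
  apply: le_trans (sum_sqr_le (h := fun b' => \sum_(c | c != 0) h a b' (c ^+ 2)) _) _.
    by move=> b; apply: sumr_ge0 => c _.
  rewrite (_ : 4 = 2 * 2); last by ring.
  rewrite -mulrA ler_wpM2l // [leRHS]mulr_sumr; apply: ler_sum => b _.
  exact: (sum_sqr_le (h := fun c' => h a b c')).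
rewrite -!mulrA ler_wpM2l //.
rewrite [leLHS](_ : _ = nrm f * \sum_x \sum_y \sum_z
   dot g (rho3 (x, y, z) *m g) * (ramanujan R x * ramanujan R y * ramanujan R z)); last first.
  rewrite -(sum_triple (fun v => dot g (rho3 v *m g) *
    (ramanujan R v.1.1 * ramanujan R v.1.2 * ramanujan R v.2))).
  rewrite mulr_sumr /h.
  under eq_bigr do under eq_bigr do rewrite exchange_big /=.
  under eq_bigr do rewrite exchange_big /=.
  rewrite exchange_big /=; apply: eq_bigr => v _.
  under eq_bigr do under eq_bigr do rewrite -mulr_sumr.
  under eq_bigr do rewrite -mulr_sumr.
  rewrite -mulr_sumr phi_dilate; ring.
rewrite [leRHS](_ : _ = nrm f * (q ^+ 3 * nrm g)); last by ring.
rewrite ler_wpM2l ?nrm_ge0 //; exact: matcoef_ramanujan.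
Qed.

End Torus.

(** * The group SL(2,q) *)

Section Mat2.
Variable F : finFieldType.
Implicit Types (a b c d x y z s : F).

Definition mat2 a b c d : 'M[F]_2 :=
  \matrix_(i, j) if i == 0 then if j == 0 then a else b
                 else if j == 0 then c else d.

Lemma ord2P (P : 'I_2 -> Prop) : P 0 -> P 1 -> forall i, P i.
Proof.
move=> h0 h1 [[|[|//]] hi].
- by rewrite (_ : Ordinal hi = 0) //; apply: val_inj.
- by rewrite (_ : Ordinal hi = 1) //; apply: val_inj.
Qed.

Lemma mat2_eq (A B : 'M[F]_2) : A 0 0 = B 0 0 -> A 0 1 = B 0 1 ->
  A 1 0 = B 1 0 -> A 1 1 = B 1 1 -> A = B.
Proof.
move=> h1 h2 h3 h4; apply/matrixP.
by apply: ord2P; apply: ord2P.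
Qed.

Lemma mul2E m p (A : 'M[F]_(m, 2)) (B : 'M[F]_(2, p)) i j : (A *m B) i j = A i 0 * B 0 j + A i 1 * B 1 j.
Proof.
rewrite mxE big_ord_recl big_ord1; congr (_ + A i _ * B _ j); exact: val_inj.
Qed.

Lemma mat2M a b c d a' b' c' d' : mat2 a b c d *m mat2 a' b' c' d' =
  mat2 (a * a' + b * c') (a * b' + b * d') (c * a' + d * c') (c * b' + d * d').
Proof. by apply: mat2_eq; rewrite mul2E !mxE. Qed.

Lemma det2E (A : 'M[F]_2) : \det A = A 0 0 * A 1 1 - A 0 1 * A 1 0.
Proof.
rewrite (expand_det_row _ 0) big_ord_recl big_ord1 /cofactor !det_mx11 !mxE /=.
rewrite (_ : lift 0 0 = 1); last exact: val_inj.
rewrite (_ : lift 1 0 = 0); last exact: val_inj.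
by rewrite expr0 expr1; ring.
Qed.

Definition smat (g : SL2 F) : 'M[F]_2 := GLval (sgval g).

(** Both coercions default to the identity, so [mkSL A] is [1] unless [A] has determinant one; in
    particular [sl_diag 0] is [1]. *)
Definition mkSL (A : 'M[F]_2) : SL2 F :=
  subg (SL2_group F) (insubd (1%g : {'GL_2[F]}) A).

Lemma smat_inj : injective smat.
Proof. by move=> g h e; apply: val_inj; apply: val_inj. Qed.

Lemma smatM g h : smat (g * h)%g = smat g *m smat h.
Proof. by []. Qed.

Lemma smat1 : smat 1%g = 1%:M.
Proof. by []. Qed.

Lemma det_smat g : \det (smat g) = 1.
Proof. by have := valP g; rewrite inE => /eqP. Qed.

Lemma smat_det g : smat g 0 0 * smat g 1 1 - smat g 0 1 * smat g 1 0 = 1.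
Proof. by rewrite -det2E det_smat. Qed.

Lemma GLvalK A : A \in unitmx -> GLval (insubd (1%g : {'GL_2[F]}) A) = A.
Proof. by move=> u; exact: insubdK. Qed.

Lemma mkSLK A : \det A = 1 -> smat (mkSL A) = A.
Proof.
move=> h; have u : A \in unitmx by rewrite unitmxE h unitr1.
by rewrite /smat subgK ?inE GLvalK // h.
Qed.

Lemma mkSL_mat2K a b c d : a * d - b * c = 1 -> smat (mkSL (mat2 a b c d)) = mat2 a b c d.
Proof. by move=> h; rewrite mkSLK // det2E !mxE. Qed.

Definition sl_upper x := mkSL (mat2 1 x 0 1).
Definition sl_lower x := mkSL (mat2 1 0 x 1).
Definition sl_weyl := mkSL (mat2 0 1 (-1) 0).
Definition sl_diag s := mkSL (mat2 s^-1 0 0 s).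

Lemma sl_upperE x : smat (sl_upper x) = mat2 1 x 0 1.
Proof. by rewrite mkSL_mat2K //; ring. Qed.
Lemma sl_lowerE x : smat (sl_lower x) = mat2 1 0 x 1.
Proof. by rewrite mkSL_mat2K //; ring. Qed.
Lemma sl_weylE : smat sl_weyl = mat2 0 1 (-1) 0.
Proof. by rewrite mkSL_mat2K //; ring. Qed.
Lemma sl_diagE s : s != 0 -> smat (sl_diag s) = mat2 s^-1 0 0 s.
Proof. by move=> s0; rewrite mkSL_mat2K ?mulVf // mulr0 subr0. Qed.

Lemma mat2_1 : 1%:M = mat2 1 0 0 1.
Proof. by apply: mat2_eq; rewrite !mxE. Qed.

Lemma sl_upperD x y : sl_upper (x + y) = (sl_upper x * sl_upper y)%g.
Proof. by apply: smat_inj; rewrite smatM !sl_upperE mat2M; congr mat2; ring. Qed.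

Lemma sl_lowerD x y : sl_lower (x + y) = (sl_lower x * sl_lower y)%g.
Proof. by apply: smat_inj; rewrite smatM !sl_lowerE mat2M; congr mat2; ring. Qed.

Lemma sl_upper0 : sl_upper 0 = 1%g.
Proof. by apply: smat_inj; rewrite sl_upperE smat1 mat2_1. Qed.

Lemma sl_lower0 : sl_lower 0 = 1%g.
Proof. by apply: smat_inj; rewrite sl_lowerE smat1 mat2_1. Qed.

Lemma sl_upperN x : sl_upper (- x) = (sl_upper x)^-1%g.
Proof. by apply/eqP; rewrite eq_sym eq_invg_mul -sl_upperD subrr sl_upper0. Qed.

Lemma sl_lowerN x : sl_lower (- x) = (sl_lower x)^-1%g.
Proof. by apply/eqP; rewrite eq_sym eq_invg_mul -sl_lowerD subrr sl_lower0. Qed.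

Lemma sl_weyl_conj x : (sl_upper x * sl_weyl = sl_weyl * sl_lower (- x))%g.
Proof.
apply: smat_inj; rewrite !smatM sl_upperE sl_lowerE sl_weylE !mat2M; congr mat2; ring.
Qed.

Lemma sl_diag_conj s x : s != 0 -> (sl_upper x * sl_diag s = sl_diag s * sl_upper (s ^+ 2 * x)%R)%g.
Proof.
move=> s0; apply: smat_inj; rewrite !smatM !sl_upperE sl_diagE // !mat2M; congr mat2; try ring.
by field.
Qed.

(** Scaling the first row by a nonzero scalar maps pairs (scalar, element) injectively into the
    general linear group, since the determinant recovers the scalar. The order of that group then
    gives q (q - 1) (q + 1). *)
Lemma card_SL2_le : (#|SL2 F| <= #|F| ^ 3)%N.
Proof.
pose h (p : F * SL2 F) : 'M[F]_2 := mat2 p.1 0 0 1 *m smat p.2.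
pose D := [set p : F * SL2 F | p.1 != 0].
have hD : #|D| = (#|F|.-1 * #|SL2 F|)%N.
  rewrite (_ : D = setX [set~ 0] [set: SL2 F]); last first.
    by apply/setP=> -[a g]; rewrite !inE andbT.
  by rewrite cardsX cardsC1 cardsT.
have hinj : {in D &, injective h}.
  move=> [a g] [b k]; rewrite !inE /= => a0 b0 e.
  have ab : a = b.
    have := congr1 determinant e; rewrite !det_mulmx !det_smat !mulr1 !det2E !mxE /=.
    by rewrite !mulr1 !mul0r !subr0.
  subst b; congr (_, _); apply: smat_inj.
  have i : mat2 a^-1 0 0 1 *m mat2 a 0 0 1 = 1%:M.
    by rewrite mat2M mat2_1 mulVf // !mulr0 !mul0r !mulr1 !addr0 !add0r.
  by rewrite -[smat g]mul1mx -[smat k]mul1mx -i -!mulmxA; congr (_ *m _).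
have hsub : h @: D \subset [set GLval x | x in ('GL_2[F])%g].
  apply/subsetP => _ /imsetP[[a g] +->]; rewrite inE /= => a0.
  have u : h (a, g) \in unitmx.
    rewrite unitmxE det_mulmx det_smat mulr1 det2E !mxE /=.
    by rewrite mulr1 mul0r subr0 unitfE.
  apply/imsetP; exists (insubd (1%g : {'GL_2[F]}) (h (a, g))); rewrite ?inE //.
  by rewrite GLvalK.
have := subset_leq_card hsub; rewrite card_in_imset // hD.
rewrite card_imset; last exact: val_inj.
rewrite card_GL_2.
have q1 : (1 < #|F|)%N by exact: card_finNzRing_gt1.
have p0 : (0 < #|F|.-1)%N by rewrite -ltnS prednK // ltnW.
rewrite (_ : (#|F| * #|F|.-1 ^ 2 * #|F|.+1 = #|F|.-1 * (#|F| * #|F|.-1 * #|F|.+1))%N); last first.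
  rewrite expnS expn1. ring.
rewrite leq_pmul2l // => /leq_trans; apply.
rewrite !expnS expn0 muln1 -mulnA leq_mul2l; apply/orP; right.
case: #|F| q1 => //= k _; rewrite !mulnS !mulSn. lia.
Qed.

End Mat2.

(** * Intertwiners and the big cell *)

Section Count.
Variable F : finFieldType.

Definition scalar_sl (b : SL2 F) : bool :=
  [&& smat b 0 1 == 0, smat b 1 0 == 0 & smat b 0 0 == smat b 1 1].

Lemma card_scalar_sl : (#|[set b : SL2 F | scalar_sl b]| <= #|F|)%N.
Proof.
rewrite -(card_in_imset (f := fun b => smat b 0 0)) ?max_card //.
move=> b b'; rewrite !inE => /and3P[/eqP h1 /eqP h2 /eqP h3].
move=> /and3P[/eqP h1' /eqP h2' /eqP h3'] e; apply: smat_inj.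
by apply: mat2_eq; rewrite ?h1 ?h2 -?h3 ?h1' ?h2' -?h3'.
Qed.

(* An intertwiner of [a] and [b] is determined by its value on a cyclic vector of [b]. *)
Lemma card_intertwiner (a b : SL2 F) : ~~ scalar_sl b ->
  (#|[set w : SL2 F | (a * w == w * b)%g]| <= #|F| ^ 2)%N.
Proof.
move=> nb.
have [v hv] : exists v : 'cV[F]_2, forall D : 'M[F]_2,
    D *m v = 0 -> D *m (smat b *m v) = 0 -> D = 0.
  have key (v : 'cV[F]_2) : v 0 0 * (smat b *m v) 1 0 - v 1 0 * (smat b *m v) 0 0 != 0 ->
      forall D : 'M[F]_2, D *m v = 0 -> D *m (smat b *m v) = 0 -> D = 0.
    set w := smat b *m v => hd D h1 h2.
    have e i (u : 'cV[F]_2) : D *m u = 0 -> D i 0 * u 0 0 + D i 1 * u 1 0 = 0.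
      by move=> /matrixP/(_ i 0); rewrite mul2E mxE.
    have hi i : D i 0 = 0 /\ D i 1 = 0.
      have e1 := e i v h1; have e2 := e i w h2.
      split; apply: (mulIf hd); rewrite mul0r.
        transitivity ((D i 0 * v 0 0 + D i 1 * v 1 0) * w 1 0 -
                      (D i 0 * w 0 0 + D i 1 * w 1 0) * v 1 0); first by ring.
        by rewrite e1 e2 !mul0r subrr.
      transitivity ((D i 0 * w 0 0 + D i 1 * w 1 0) * v 0 0 -
                    (D i 0 * v 0 0 + D i 1 * v 1 0) * w 0 0); first by ring.
      by rewrite e1 e2 !mul0r subrr.
    have [h00 h01] := hi 0; have [h10 h11] := hi 1.
    by apply: mat2_eq; rewrite mxE.
  move: nb; rewrite /scalar_sl !negb_and.
  pose mk (x y : F) : 'cV[F]_2 := \col_i if i == 0 then x else y.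
  (* If the two basis vectors are both eigenvectors then [b] is diagonal, and not being scalar it
     moves the line of their sum. So one of the three vectors is cyclic. *)
  have [h10 _|h10] := boolP (smat b 1 0 != 0).
    by exists (mk 1 0); apply: key; rewrite !mul2E !mxE /=;
       apply: contraNneq h10 => <-; apply/eqP; ring.
  have [h01 _|h01] := boolP (smat b 0 1 != 0).
    by exists (mk 0 1); apply: key; rewrite !mul2E !mxE /= -oppr_eq0;
       apply: contraNneq h01 => <-; apply/eqP; ring.
  rewrite /= => hd; exists (mk 1 1); apply: key; rewrite !mul2E !mxE /= -oppr_eq0.
  move: h10 h01; rewrite !negbK => /eqP-> /eqP->.
  by move: hd; rewrite -subr_eq0; apply: contraNneq => <-; apply/eqP; ring.
pose h (w : SL2 F) := smat w *m v.
rewrite -(card_in_imset (f := h)).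
  by apply: leq_trans (max_card _) _; rewrite card_mx muln1.
move=> w w'; rewrite !inE => /eqP/(congr1 (@smat F)) e /eqP/(congr1 (@smat F)) e'.
rewrite !smatM in e e'.
rewrite /h => hvv; apply: smat_inj; apply/eqP; rewrite -subr_eq0; apply/eqP.
apply: hv; first by rewrite mulmxBl hvv subrr.
by rewrite mulmxA mulmxBl -e -e' -mulmxBr -mulmxA mulmxBl hvv subrr mulmx0.
Qed.

Definition inter_bound (b : SL2 F) : nat :=
  if scalar_sl b then #|SL2 F| else (#|F| ^ 2)%N.

Lemma card_intertwiner_le (a b : SL2 F) :
  (#|[set w : SL2 F | (a * w == w * b)%g]| <= inter_bound b)%N.
Proof.
rewrite /inter_bound; case: ifPn => [_|]; first exact: max_card.
exact: card_intertwiner.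
Qed.

(** Scalars get the trivial bound, but they number at most [#|F|], so their share does not exceed
    the main term. *)
Lemma sum_inter_bound : (\sum_b inter_bound b <= 2 * (#|SL2 F| * #|F| ^ 2))%N.
Proof.
rewrite (bigID (@scalar_sl)) /= mul2n -addnn; apply: leq_add.
  rewrite (eq_bigr (fun=> #|SL2 F|)); last by rewrite /inter_bound => b ->.
  rewrite sum_nat_const mulnC leq_mul2l; apply/orP; right.
  apply: leq_trans (_ : #|F| <= _)%N; last by rewrite expnS expn1 leq_pmulr // (cardD1 0).
  by apply: leq_trans card_scalar_sl; rewrite cardsE.
rewrite (eq_bigr (fun=> #|F| ^ 2)%N); last by rewrite /inter_bound => b /negPf->.
by rewrite sum_nat_const leq_mul2r max_card orbT.
Qed.

Lemma card_borel_le : (#|[set g : SL2 F | (smat g 1 0 == 0)%R]| <= #|F| ^ 2)%N.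
Proof.
rewrite -(card_in_imset (f := fun g => (smat g 0 0, smat g 0 1))).
  by apply: leq_trans (max_card _) _; rewrite card_prod expnS expn1.
move=> g g'; rewrite !inE => /eqP h /eqP h' [e1 e2]; apply: smat_inj.
have d := smat_det g; have d' := smat_det g'.
rewrite h mulr0 subr0 in d; rewrite h' mulr0 subr0 in d'.
apply: mat2_eq; rewrite ?h ?h' //.
have n0 : smat g 0 0 != 0 by apply: contra_eq_neq d => ->; rewrite mul0r eq_sym oner_eq0.
by apply: (mulfI n0); rewrite d e1 d'.
Qed.

Definition sl_ulu (p : F * F * F) := (sl_upper p.1.1 * sl_lower p.1.2 * sl_upper p.2)%g.

Lemma sl_uluE p : smat (sl_ulu p) = mat2 (1 + p.1.1 * p.1.2)
  (p.2 + p.1.1 * p.1.2 * p.2 + p.1.1) p.1.2 (1 + p.1.2 * p.2).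
Proof. by rewrite !smatM !sl_upperE sl_lowerE !mat2M; congr mat2; ring. Qed.

(** Coordinates on the big cell: the lower left entry is the middle parameter, the diagonal entries
    then give the outer two, and the determinant forces the last entry. *)
Lemma sum_sl_ulu (V : nmodType) (h : SL2 F -> V) :
  \sum_(p | p.1.2 != 0) h (sl_ulu p) = \sum_(g | smat g 1 0 != 0) h g.
Proof.
pose k (g : SL2 F) : F * F * F :=
  ((smat g 0 0 - 1) / smat g 1 0, smat g 1 0, (smat g 1 1 - 1) / smat g 1 0).
rewrite [RHS](reindex_onto sl_ulu k) /=.
  apply: eq_bigl => -[[x y] z]; rewrite sl_uluE mxE /=.
  case: eqVneq => //= y0; symmetry; apply/eqP; rewrite /k sl_uluE !mxE /=.
  by congr (_, _, _); field.
move=> g g0; apply: smat_inj; rewrite sl_uluE /=; have d := smat_det g.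
apply: mat2_eq; rewrite !mxE /=; [by field| |by []|by field].
have e : smat g 0 1 * smat g 1 0 = smat g 0 0 * smat g 1 1 - 1 by rewrite -d; ring.
by apply: (mulIf g0); rewrite e; field.
Qed.

End Count.

(** * Upper and lower unipotents against the whole group *)

Section Gap.
Variables (R : rcfType) (N : nat) (F : finFieldType).
Local Notation q := (#|F|%:R : R).
Variable rho : SL2 F -> 'M[R]_N.
Hypothesis rhoP : orep rho.

Lemma orep_upper : orep (rho \o @sl_upper F).
Proof.
split=> [x y|x|] /=.
- by rewrite FinRing.zmodMgE sl_upperD (orepM rhoP).
- by rewrite (orepV rhoP) FinRing.zmodVgE sl_upperN.
- by rewrite (sl_upper0 F : sl_upper 1%g = _) (orep1 rhoP).
Qed.

Lemma orep_lower : orep (rho \o @sl_lower F).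
Proof.
split=> [x y|x|] /=.
- by rewrite FinRing.zmodMgE sl_lowerD (orepM rhoP).
- by rewrite (orepV rhoP) FinRing.zmodVgE sl_lowerN.
- by rewrite (sl_lower0 F : sl_lower 1%g = _) (orep1 rhoP).
Qed.

Local Notation eu := (avg (rho \o @sl_upper F)).
Local Notation el := (avg (rho \o @sl_lower F)).

Lemma gap_expand f : q ^+ 3 * dot f (eu *m (el *m (eu *m f))) =
  \sum_p dot f (rho (sl_ulu p) *m f).
Proof.
have q0 : q != 0 := cardG_neq0 R F.
rewrite sum_triple /avg -!scalemxAl -!scalemxAr !dotZr.
transitivity (dot f ((\sum_x (rho \o @sl_upper F) x) *m ((\sum_x (rho \o @sl_lower F) x) *m
   ((\sum_x (rho \o @sl_upper F) x) *m f)))); first by field.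
rewrite mulmx_suml dot_sumr; apply: eq_bigr => x _.
rewrite mulmx_suml mulmx_sumr dot_sumr; apply: eq_bigr => y _.
rewrite mulmx_suml !mulmx_sumr dot_sumr; apply: eq_bigr => z _ /=.
by rewrite /sl_ulu !(orepM rhoP) !mulmxA.
Qed.

Lemma dot_orep_le g f : `|dot f (rho g *m f)| <= nrm f.
Proof.
rewrite ler_norml; have h1 := dot_le f (rho g *m f).
have h2 := dot_le (- f) (rho g *m f).
by rewrite !nrmN dotNl !(nrm_orep rhoP) in h1 h2; lra.
Qed.

(* In [e^+ e^- e^+] the words [u l u'] with [l <> 1] run once through the elements
   outside the upper triangular subgroup, so up to two terms of relative size
   [1/q] this product is the average over the whole group. *)
Lemma gap f : avg rho *m f = 0 -> nrm (el *m (eu *m f)) <= 2 / q * nrm f.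
Proof.
move=> hf.
have q0 : 0 < q by rewrite lt0r (cardG_neq0 R F) ler0n.
have [uI uT] := proj_avg orep_upper; have [lI lT] := proj_avg orep_lower.
(* Both averages are orthogonal projections, so the squared norm is the coefficient of [eu el eu] at
   [f]. *)
rewrite /nrm dot_mull lT mulmxA lI dot_mull uT -(ler_pM2l (exprn_gt0 3 q0)) gap_expand.
have s0 : \sum_g dot f (rho g *m f) = 0.
  move: hf; rewrite /avg -scalemxAl mulmx_suml => /eqP.
  rewrite scaler_eq0 invr_eq0 (negPf (cardG_neq0 R (SL2 F))) /= => /eqP h.
  by rewrite -dot_sumr h dot0r.
rewrite (bigID (fun p : F * F * F => p.1.2 != 0)) /= (sum_sl_ulu (fun g => dot f (rho g *m f))).
(* Mean zero trades the sum over the big cell for minus the sum over the upper triangular subgroup.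
   What remains is at most [q ^+ 2] group elements and the [q ^+ 2] words with trivial middle
   letter. *)
move: s0; rewrite (bigID (fun g => smat g 1 0 != 0)) /= => /eqP.
rewrite addr_eq0 => /eqP->.
have h1 : - \sum_(g | ~~ (smat g 1 0 != 0)) dot f (rho g *m f) <= q ^+ 2 * nrm f.
  rewrite -sumrN; apply: le_trans (_ : \sum_(g | ~~ (smat g 1 0 != 0)) nrm f <= _).
    by apply: ler_sum => g _; have := dot_orep_le g f; rewrite ler_norml; lra.
  rewrite sumr_const -[leLHS]mulr_natl ler_wpM2r ?nrm_ge0 // -natrX ler_nat.
  apply: leq_trans (card_borel_le F); rewrite cardsE; apply: subset_leq_card.
  by apply/subsetP => g; rewrite !unfold_in negbK.
have h2 : \sum_(p | ~~ (p.1.2 != 0)) dot f (rho (sl_ulu p) *m f) <= q ^+ 2 * nrm f.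
  apply: le_trans (_ : \sum_(p : F * F * F | ~~ (p.1.2 != 0)) nrm f <= _).
    by apply: ler_sum => g _; have := dot_orep_le (sl_ulu g) f; rewrite ler_norml; lra.
  rewrite sumr_const -[leLHS]mulr_natl ler_wpM2r ?nrm_ge0 // -natrX ler_nat.
  apply: leq_trans (_ : #|(fun u : F * F => (u.1, 0%R, u.2)) @: [set: F * F]| <= _)%N.
    apply: subset_leq_card; apply/subsetP => -[[x y] z]; rewrite unfold_in negbK /= => /eqP->.
    by apply/imsetP; exists (x, z); rewrite ?inE.
  by apply: leq_trans (leq_imset_card _ _) _; rewrite cardsT card_prod expnS expn1.
apply: le_trans (lerD h1 h2) _; rewrite le_eqVlt; apply/orP; left; apply/eqP.
by rewrite /nrm; field; rewrite gt_eqF.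
Qed.

Lemma avg_upper_weyl : eu *m rho (sl_weyl F) = rho (sl_weyl F) *m el.
Proof.
rewrite /avg -scalemxAl -scalemxAr mulmx_suml mulmx_sumr; congr (_ *: _).
rewrite [RHS](reindex_inj (@oppr_inj F)); apply: eq_bigr => x _ /=.
by rewrite -!(orepM rhoP) sl_weyl_conj.
Qed.

(** The kernels of [K1] and [K2] carry the conditions on the other two coordinates, which must
    survive applying [eu], [el] and the Weyl element. *)
Variables (C K1 K2 : 'M[R]_N).
Hypothesis cC : forall g, rho g *m C = C *m rho g.
Hypothesis cK1 : forall g, rho g *m K1 = K1 *m rho g.
Hypothesis cK2 : forall g, rho g *m K2 = K2 *m rho g.
Hypothesis C1 : opn 1 C.

(* A vector fixed by the upper unipotents has a small component fixed by the lower
   ones, and the Weyl element moves the rest to a vector without upper-fixed part. *)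
Lemma opn_extend c : 0 <= c ->
  (forall f, K1 *m f = 0 -> K2 *m f = 0 -> eu *m f = 0 -> nrm (C *m f) <= c * nrm f) ->
  forall f, K1 *m f = 0 -> K2 *m f = 0 -> avg rho *m f = 0 ->
    nrm (C *m f) <= (c + 2 / q) * nrm f.
Proof.
move=> c0 H f h1 h2 h3.
have pu := proj_avg orep_upper; have pl := proj_avg orep_lower.
have cu A : (forall g, rho g *m A = A *m rho g) -> eu *m A = A *m eu.
  by move=> h; apply: comm_avg => x; exact: h.
have cl A : (forall g, rho g *m A = A *m rho g) -> el *m A = A *m el.
  by move=> h; apply: comm_avg => x; exact: h.
have uK A (u : 'cV[R]_N) : (forall g, rho g *m A = A *m rho g) -> A *m u = 0 -> A *m (eu *m u) = 0.
  by move=> h hu; rewrite mulmxA -cu // -mulmxA hu mulmx0.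
have lK A (u : 'cV[R]_N) : (forall g, rho g *m A = A *m rho g) -> A *m u = 0 -> A *m (el *m u) = 0.
  by move=> h hu; rewrite mulmxA -cl // -mulmxA hu mulmx0.
have cpl (e A : 'M[R]_N) : e *m A = A *m e -> (1%:M - e) *m A = A *m (1%:M - e).
  by move=> h; rewrite mulmxBl mulmxBr h mul1mx mulmx1.
rewrite (proj_nrm (C *m f) pu) !mulmxA cu // (cpl _ _ (cu _ cC)) -!mulmxA.
have b1 : nrm (C *m ((1%:M - eu) *m f)) <= c * nrm ((1%:M - eu) *m f).
  apply: H.
  - by rewrite mulmxBl mul1mx mulmxBr h1 uK // subrr.
  - by rewrite mulmxBl mul1mx mulmxBr h2 uK // subrr.
  - by rewrite mulmxBl mul1mx mulmxBr mulmxA pu.1 subrr.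
set f0 := eu *m f.
rewrite (proj_nrm (C *m f0) pl) !mulmxA cl // (cpl _ _ (cl _ cC)) -!mulmxA.
have b2 : nrm (C *m (el *m f0)) <= 2 / q * nrm f.
  by apply: le_trans (C1 _) _; rewrite mul1r gap.
have b3 : nrm (C *m ((1%:M - el) *m f0)) <= c * nrm f0.
  set f2 := (1%:M - el) *m f0.
  rewrite -(nrm_orep rhoP (sl_weyl F)) mulmxA cC -mulmxA.
  have k0 A : (forall g, rho g *m A = A *m rho g) -> A *m f = 0 -> A *m (rho (sl_weyl F) *m f2) = 0.
    move=> hA hf; rewrite mulmxA -hA -mulmxA /f2 mulmxBl mul1mx mulmxBr.
    by rewrite (lK A f0) ?uK // subrr mulmx0.
  apply: le_trans (H _ _ _ _) _; [exact: k0 | exact: k0 | |].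
    by rewrite mulmxA avg_upper_weyl -mulmxA /f2 mulmxBl mul1mx mulmxBr mulmxA pl.1 subrr mulmx0.
  rewrite (nrm_orep rhoP) ler_wpM2l // (proj_nrm f0 pl) lerDr; exact: nrm_ge0.
have := proj_nrm f pu; rewrite -/f0 mulrDl => e; rewrite {1}e mulrDr; lra.
Qed.

End Gap.

(** * Quasirandomness *)

Section Quasirandom.
Variables (R : rcfType) (N : nat) (F : finFieldType).
Local Notation q := (#|F|%:R : R).
Variables (r0 r1 r2 : SL2 F -> 'M[R]_N).
Hypotheses (r0P : orep r0) (r1P : orep r1) (r2P : orep r2).
Hypothesis c01 : forall g h, r0 g *m r1 h = r1 h *m r0 g.
Hypothesis c02 : forall g h, r0 g *m r2 h = r2 h *m r0 g.
Hypothesis c12 : forall g h, r1 g *m r2 h = r2 h *m r1 g.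
Variable C : 'M[R]_N.
Hypothesis cC0 : forall g, r0 g *m C = C *m r0 g.
Hypothesis cC1 : forall g, r1 g *m C = C *m r1 g.
Hypothesis cC2 : forall g, r2 g *m C = C *m r2 g.
Hypothesis C1 : opn 1 C.

Lemma nrm_mulmx (u : 'cV[R]_N) : nrm (C *m u) = \sum_i dot (row i C)^T u ^+ 2.
Proof.
rewrite /nrm dotE mxE; apply: eq_bigr => i _.
by rewrite !mxE dotE trmxK -row_mul !mxE expr2.
Qed.

(** A Bessel bound for the family [v] is applied to every row of [C], whose squared norms add up to
    the trace. *)
Lemma sum_nrm_le (I : finType) (v : I -> 'cV[R]_N) c :
  (forall g, \sum_i dot g (v i) ^+ 2 <= c * nrm g) ->
  \sum_i nrm (C *m v i) <= c * \tr (C *m C^T).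
Proof.
move=> h; under eq_bigr do rewrite nrm_mulmx.
rewrite exchange_big /= trace_mulT mulr_sumr.
by apply: ler_sum => i _.
Qed.

Definition diag3 (a b c : F) := r0 (sl_diag a) *m r1 (sl_diag b) *m r2 (sl_diag c).
Local Notation u3 := (rho3 (r0 \o @sl_upper F) (r1 \o @sl_upper F) (r2 \o @sl_upper F)).

Lemma upper3_diag3 x y z a b c : a != 0 -> b != 0 -> c != 0 ->
  u3 (x, y, z) *m diag3 a b c = diag3 a b c *m u3 (a ^+ 2 * x, b ^+ 2 * y, c ^+ 2 * z).
Proof.
move=> a0 b0 c0; rewrite /rho3 /diag3 /= -!mulmxA.
rewrite -(mulmxCA _ (c02 _ _)) -(mulmxCA _ (c01 _ _)) (mulmxA (r0 (sl_upper x))) -(orepM r0P) sl_diag_conj //.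
rewrite (orepM r0P) -!mulmxA; congr (_ *m _).
rewrite -(mulmxCA _ (c12 _ _)) (mulmxA (r1 (sl_upper y))) -(orepM r1P) sl_diag_conj //.
rewrite -(orepM r2P) sl_diag_conj // (orepM r1P) (orepM r2P).
by rewrite -!mulmxA -(mulmxCA _ (c02 _ _)) -(mulmxCA _ (c01 _ _)) -(mulmxCA _ (c12 _ _)).
Qed.

Lemma diag3_isom a b c : (diag3 a b c)^T *m diag3 a b c = 1%:M.
Proof.
rewrite /diag3 !trmx_mul -!mulmxA (mulmxA (r0 _)^T) (orep_isom r0P) mul1mx.
by rewrite (mulmxA (r1 _)^T) (orep_isom r1P) mul1mx (orep_isom r2P).
Qed.

Lemma nrm_mulmx_upper3 p a b c f : nrm (C *m (u3 p *m (diag3 a b c *m f))) = nrm (C *m f).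
Proof.
have -> : C *m (u3 p *m (diag3 a b c *m f)) = u3 p *m (diag3 a b c *m (C *m f)).
  rewrite /rho3 /diag3 /= -!mulmxA.
  rewrite -!(mulmxCA _ (cC0 _)) -!(mulmxCA _ (cC1 _)) -!(mulmxCA _ (cC2 _)).
  rewrite -!(mulmxCA _ (cC0 _)) -!(mulmxCA _ (cC1 _)) -!(mulmxCA _ (cC2 _)) //.
rewrite /rho3 /diag3 /= -!mulmxA.
by rewrite !(nrm_orep r0P, nrm_orep r1P, nrm_orep r2P).
Qed.

Local Notation e0 := (avg (r0 \o @sl_upper F)).
Local Notation e1 := (avg (r1 \o @sl_upper F)).
Local Notation e2 := (avg (r2 \o @sl_upper F)).
Local Notation bnd := (8 / (q - 1) ^+ 3 * \tr (C *m C^T)).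

Lemma q_gt1 : 1 < q.
Proof. by rewrite ltr1n; exact: card_finNzRing_gt1. Qed.

(** Stands in for the fact that representations nontrivial in all three factors have dimension at
    least ((q - 1) / 2)^3. [C] commutes with the translations, so all (q - 1)^3 q^3 translates of
    [f] have images of equal norm, while the Bessel inequality bounds the sum of these by 8 q^3
    times the trace. *)
Lemma trace_bound f : e0 *m f = 0 -> e1 *m f = 0 -> e2 *m f = 0 ->
  nrm (C *m f) <= bnd * nrm f.
Proof.
move=> h0 h1 h2; have q1 := q_gt1.
(* A subtype, since [sum_nrm_le] sums over a whole finite type. *)
pose I := {x : F | x != 0}.
have sI (h : F -> R) : \sum_(x | x != 0) h x = \sum_(i : I) h (val i).
  rewrite (reindex_onto val (insubd (exist _ 1 (oner_neq0 _) : I))) /=.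
    by apply: eq_big => [i|//]; rewrite (valP i) valKd eqxx.
  by move=> x x0; rewrite insubdK.
have cardI : #|{: I}|%:R = q - 1 :> R.
  rewrite card_sig -(cardC (pred1 (0 : F))) card1 natrD addrAC subrr add0r.
  by congr _%:R; apply: eq_card => c; rewrite !inE.
pose v (p : I * I * I * (F * F * F)) :=
  u3 p.2 *m (diag3 (val p.1.1.1) (val p.1.1.2) (val p.1.2) *m f).
have e : \sum_p nrm (C *m v p) =
    (q - 1) * (q - 1) * (q - 1) * (q * q * q) * nrm (C *m f).
  rewrite (eq_bigr (fun=> nrm (C *m f))); last by move=> p _; exact: nrm_mulmx_upper3.
  by rewrite sumr_const !card_prod -[LHS]mulr_natl !natrM cardI.
have p1 : 0 < (q - 1) ^+ 3 by rewrite exprn_gt0 // subr_gt0.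
have p2 : 0 < q ^+ 3 by rewrite exprn_gt0 // (lt_trans _ q1).
rewrite -(ler_pM2l p2) -(ler_pM2l p1).
rewrite [leLHS](_ : _ = (q - 1) * (q - 1) * (q - 1) * (q * q * q) * nrm (C *m f)); last by ring.
rewrite -e [leRHS](_ : _ = 8 * q ^+ 3 * nrm f * \tr (C *m C^T)); last by field; rewrite lt0r_neq0 // subr_gt0.
apply: sum_nrm_le => g.
have := torus_matcoef_sqr_le (orep_upper r0P) (orep_upper r1P) (orep_upper r2P)
  (fun x y => c01 (sl_upper x) (sl_upper y)) (fun x y => c02 (sl_upper x) (sl_upper y))
  (fun x y => c12 (sl_upper x) (sl_upper y)) h0 h1 h2 (theta := diag3) _ g.
rewrite sI; under eq_bigr do rewrite sI; under eq_bigr do under eq_bigr do rewrite sI.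
rewrite pair_bigA /= pair_bigA /= pair_bigA /=; apply.
move=> a b c a0 b0 c0 x y z u.
by rewrite mulmxA upper3_diag3 // -mulmxA dot_mull mulmxA diag3_isom mul1mx.
Qed.

Lemma orep_comm_avg (H K : finGroupType) (r : H -> 'M[R]_N) (s : K -> 'M[R]_N) :
  (forall g h, r g *m s h = s h *m r g) -> forall g, r g *m avg s = avg s *m r g.
Proof. by move=> h g; rewrite (@comm_avg _ _ _ s) // => x; rewrite h. Qed.

(** [trace_bound] needs no unipotent-fixed part. [opn_extend] relaxes this to mean zero in one
    coordinate at a time, at a cost of [2 / q] for each of the three. *)
Lemma quasirandom f : avg r0 *m f = 0 -> avg r1 *m f = 0 -> avg r2 *m f = 0 ->
  nrm (C *m f) <= (bnd + 6 / q) * nrm f.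
Proof.
have q1 := q_gt1.
have b0 : 0 <= bnd.
  apply: mulr_ge0; last exact: trace_ge0.
  by rewrite divr_ge0 // exprn_ge0 // subr_ge0 ltW.
have q2 : 0 <= 2 / q by rewrite divr_ge0.
have st2 := opn_extend (K1 := e0) (K2 := e1) r2P cC2 _ _ C1 b0 _.
have {st2} st2 : forall f, e0 *m f = 0 -> e1 *m f = 0 -> avg r2 *m f = 0 ->
    nrm (C *m f) <= (bnd + 2 / q) * nrm f.
  apply: st2; last exact: trace_bound.
    by apply: orep_comm_avg => g h /=; rewrite c02.
  by apply: orep_comm_avg => g h /=; rewrite c12.
have b1 : 0 <= bnd + 2 / q by rewrite addr_ge0.
have st1 := opn_extend (K1 := e0) (K2 := avg r2) r1P cC1 _ _ C1 b1 _.
have {st1} st1 : forall f, e0 *m f = 0 -> avg r2 *m f = 0 -> avg r1 *m f = 0 ->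
    nrm (C *m f) <= (bnd + 2 / q + 2 / q) * nrm f.
  apply: st1; last by move=> u h0 h2 h1; exact: st2.
    by apply: orep_comm_avg => g h /=; rewrite c01.
  by apply: orep_comm_avg => g h /=; rewrite c12.
have b2 : 0 <= bnd + 2 / q + 2 / q by rewrite addr_ge0.
have st0 := opn_extend (K1 := avg r1) (K2 := avg r2) r0P cC0 _ _ C1 b2 _.
move=> h0 h1 h2.
have -> : bnd + 6 / q = bnd + 2 / q + 2 / q + 2 / q by ring.
apply: st0 h1 h2 h0; try exact: orep_comm_avg.
by move=> u k1 k2 k0; exact: st1.
Qed.

End Quasirandom.

(** * The trace bound *)

Section TraceChain.
Variables (R : rcfType) (N : nat).
Implicit Types A D K P : 'M[R]_N.

(** Positive semidefiniteness in dual form. Gram matrices satisfy it at once and conjugation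
    preserves it, so traces are compared without square roots or diagonalisation. *)
Definition sos K := forall D, psdq D -> 0 <= \tr (D *m K).

Lemma psdq_conj A D : psdq D -> psdq (A *m D *m A^T).
Proof. by move=> h u; rewrite -!mulmxA dot_mulr mulmxA -mulmxA; exact: h. Qed.

Lemma sos_conj A K : sos K -> sos (A^T *m K *m A).
Proof.
move=> h D hD; rewrite !mulmxA mxtrace_mulC !mulmxA; apply: h.
exact: psdq_conj.
Qed.

Lemma sos_sqr A : sos (A^T *m A).
Proof. by move=> D hD; exact: trace_psdq. Qed.

Lemma sos_gram (I : finType) (c : R) (X : I -> 'M[R]_N) : 0 <= c ->
  sos (c *: \sum_i (X i)^T *m X i).
Proof.
move=> c0 D hD; rewrite -scalemxAr mxtraceZ mulr_ge0 //.
rewrite mulmx_sumr raddf_sum; apply: sumr_ge0 => i _; exact: trace_psdq.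
Qed.

Lemma psdq_gram (I : finType) (Y : I -> 'M[R]_N) :
  psdq (#|I|%:R *: (\sum_i (Y i)^T *m Y i) - (\sum_i Y i)^T *m (\sum_i Y i)).
Proof.
move=> u; rewrite mulmxBl dotDr dotNr subr_ge0.
rewrite -mulmxA dot_mulr trmxK mulmx_suml -/(nrm _).
apply: le_trans (nrm_sum_le _) _.
rewrite -scalemxAl dotZr ler_wpM2l ?ler0n // mulmx_suml dot_sumr.
by apply: ler_sum => i _; rewrite -mulmxA dot_mulr trmxK.
Qed.

(** The factors are replaced one by one, P P P P to K P P P to K P K P, then the remaining P by K'
    likewise. Up to cyclic rotation the other three factors always form a conjugate A B A of a
    positive B, against which the difference has nonnegative trace. *)
Lemma trace_pow4_le P K K' : P^T = P -> K^T = K -> sos P -> sos K -> sos K' ->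
  psdq (K - P) -> psdq (K' - P) ->
  \tr (P *m P *m P *m P) <= \tr (K *m K' *m K *m K').
Proof.
move=> sP sK oP oK oK' dK dK'.
have PKP : sos (P *m K *m P) by rewrite -{1}sP; exact: sos_conj.
have PPP : sos (P *m P *m P) by rewrite -{1}sP; exact: sos_conj.
have KKK : sos (K *m K' *m K) by rewrite -{1}sK; exact: sos_conj.
have KPK : sos (K *m P *m K) by rewrite -{1}sK; exact: sos_conj.
have h1 := PKP _ dK; have h2 := PPP _ dK; have h3 := KKK _ dK'; have h4 := KPK _ dK'.
apply: (@le_trans _ _ (\tr (K *m P *m K *m P))).
  rewrite mulmxBl linearB /= in h1; rewrite mulmxBl linearB /= in h2.
  have e1 : \tr (P *m (P *m K *m P)) = \tr (K *m (P *m P *m P)).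
    by rewrite mxtrace_mulC -!mulmxA mxtrace_mulC -!mulmxA.
  by rewrite e1 !mulmxA in h1 h2 *; lra.
rewrite mulmxBl linearB /= in h3; rewrite mulmxBl linearB /= in h4.
have e1 : \tr (P *m (K *m K' *m K)) = \tr (K' *m (K *m P *m K)).
  by rewrite mxtrace_mulC -!mulmxA mxtrace_mulC -!mulmxA.
have e2 : \tr (K *m P *m K *m P) = \tr (P *m (K *m P *m K)) by rewrite mxtrace_mulC.
have e3 : \tr (K *m K' *m K *m K') = \tr (K' *m (K *m K' *m K)) by rewrite mxtrace_mulC.
rewrite e2 e3; lra.
Qed.

End TraceChain.

(** * Counting coincidences of products *)

Section Collision.
Variables (R : rcfType) (G : finGroupType).
Variables (k k' : G -> G -> R) (c : R).
Hypotheses (k0 : forall m w, 0 <= k m w) (k0' : forall m w, 0 <= k' m w).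
Hypotheses (kr : forall m, \sum_w k m w <= c) (kc : forall w, \sum_m k m w <= c).
Hypotheses (kr' : forall m, \sum_w k' m w <= c) (kc' : forall w, \sum_m k' m w <= c).
Variable cap : G -> nat.
Hypothesis capP : forall a b, (#|[set w : G | (a * w == w * b)%g]| <= cap b)%N.

Definition overlap (f : G -> G -> R) w w' := \sum_m f m w * f m w'.

Lemma overlap_ge0 (f : G -> G -> R) w w' : (forall m w, 0 <= f m w) -> 0 <= overlap f w w'.
Proof. by move=> f0; apply: sumr_ge0 => m _; exact: mulr_ge0. Qed.

Lemma overlap_sum (f : G -> G -> R) w : (forall m w, 0 <= f m w) ->
  (forall m, \sum_w f m w <= c) -> (forall w, \sum_m f m w <= c) ->
  \sum_w' overlap f w w' <= c ^+ 2.
Proof.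
move=> f0 fr fc; rewrite /overlap exchange_big /=.
apply: le_trans (_ : \sum_m f m w * c <= _).
  by apply: ler_sum => m _; rewrite -mulr_sumr ler_wpM2l.
rewrite -mulr_suml expr2 ler_wpM2r // (le_trans _ (fr w)) //.
by apply: sumr_ge0 => i _.
Qed.

Definition collision : R :=
  \sum_w \sum_w' overlap k w w' *
    \sum_v \sum_v' overlap k' v v' * (w * v == v' * w')%g%:R.

Lemma collision_ge0 : 0 <= collision.
Proof.
apply: sumr_ge0 => w _; apply: sumr_ge0 => w' _; apply: mulr_ge0; first exact: overlap_ge0.
by apply: sumr_ge0 => v _; apply: sumr_ge0 => v' _; rewrite mulr_ge0 ?overlap_ge0.
Qed.

Lemma weighted_sqr_le (I : finType) (w f : I -> R) : (forall i, 0 <= w i) ->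
  (\sum_i w i * f i) ^+ 2 <= (\sum_i w i) * \sum_i w i * f i ^+ 2.
Proof.
move=> w0.
have h2 : 0 < 2 :> R by [].
rewrite -(ler_pM2l h2) expr2 !mulr_suml !mulr_sumr.
rewrite [leRHS](_ : _ = \sum_i \sum_j (w i * w j * (f i ^+ 2 + f j ^+ 2))).
  apply: ler_sum => i _; rewrite mulr_sumr mulr_sumr; apply: ler_sum => j _.
  rewrite [leLHS](_ : _ = w i * w j * (2 * f i * f j)); last by ring.
  rewrite ler_wpM2l ?mulr_ge0 // -subr_ge0.
  by rewrite (_ : _ - _ = (f i - f j) ^+ 2) ?sqr_ge0 //; ring.
transitivity (\sum_i \sum_j (w i * w j * f i ^+ 2) + \sum_i \sum_j (w i * w j * f j ^+ 2)).
  rewrite [X in X + _]exchange_big /= -big_split /=; apply: eq_bigr => i _.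
  by rewrite mulr_sumr mulr_sumr -big_split; apply: eq_bigr => j _ /=; ring.
rewrite -big_split; apply: eq_bigr => i _ /=; rewrite -big_split.
by apply: eq_bigr => j _ /=; rewrite mulrDr.
Qed.

Let Fc (w w' : G) := \sum_v \sum_v' overlap k' v v' * (w * v == v' * w')%g%:R.

(** Eliminating [w'] from the two equations leaves [t' v'^-1 w = w t v^-1], so [w] intertwines two
    elements fixed by the other variables, and [w'] contributes only a row sum of overlaps. *)
Lemma inner_le (v v' t t' : G) :
  \sum_w \sum_w' overlap k w w' * ((w * v == v' * w')%g%:R * (w * t == t' * w')%g%:R)
  <= c ^+ 2 * (cap (t * v^-1)%g)%:R.
Proof.
apply: le_trans (_ : \sum_w c ^+ 2 * (t' * v'^-1 * w == w * (t * v^-1))%g%:R <= _).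
  apply: ler_sum => w _; case: eqP => [_|h] /=.
    rewrite mulr1; apply: le_trans (overlap_sum w k0 kr kc).
    apply: ler_sum => w' _; rewrite ler_piMr ?overlap_ge0 //.
    by case: eqP => _; case: eqP => _; rewrite ?mulr1 ?mulr0 ?mul0r.
  rewrite mulr0 big1 // => w' _.
  case: eqP => [e1|]; last by rewrite mul0r mulr0.
  case: eqP => [e2|]; last by rewrite mulr0 mulr0.
  case: h; rewrite mulgA e2 -!mulgA; congr (_ * _)%g.
  by apply: (mulgI v'); rewrite mulKVg mulgA -e1 mulgK.
rewrite -mulr_sumr ler_wpM2l ?sqr_ge0 // -natr_sum ler_nat.
apply: leq_trans (capP (t' * v'^-1)%g (t * v^-1)%g).
by rewrite -sum1dep_card [leqRHS]big_mkcond /=; apply: leq_sum => w _; case: eqP.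
Qed.

(** A single equation imposes too little; Cauchy-Schwarz over [(w, w')] duplicates the inner sum and
    produces the pair of equations of [inner_le]. The weights give [#|G| * c ^+ 2]. The duplicated
    sum gives [c ^+ 2] from [w'], [c ^+ 4] from [v'] and [t'], and [#|G|] times the sum of [cap]
    from [v] and [t]. *)
Lemma collision_sqr_le :
  collision ^+ 2 <= #|G|%:R ^+ 2 * c ^+ 8 * (\sum_b cap b)%:R.
Proof.
have c0 : 0 <= c by apply: le_trans (kr 1%g); apply: sumr_ge0.
rewrite /collision pair_bigA /=.
apply: le_trans (weighted_sqr_le (fun p : G * G => Fc p.1 p.2)
   (fun p => overlap_ge0 p.1 p.2 k0)) _.
have h1 : \sum_(p : G * G) overlap k p.1 p.2 <= #|G|%:R * c ^+ 2.
  rewrite -(pair_bigA _ (fun w w' => overlap k w w')) /=.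
  apply: le_trans (_ : \sum_(w : G) c ^+ 2 <= _).
    by apply: ler_sum => w _; exact: overlap_sum.
  by rewrite sumr_const mulr_natl.
have h2 : \sum_(p : G * G) overlap k p.1 p.2 * Fc p.1 p.2 ^+ 2 <=
    #|G|%:R * c ^+ 6 * (\sum_b cap b)%:R.
  rewrite [leLHS](_ : _ = \sum_v \sum_v' \sum_t \sum_t'
      overlap k' v v' * overlap k' t t' *
      \sum_w \sum_w' overlap k w w' * ((w * v == v' * w')%g%:R * (w * t == t' * w')%g%:R)); last first.
    transitivity (\sum_(p : G * G) \sum_(r : G * G) \sum_(s : G * G)
        overlap k p.1 p.2 * (overlap k' r.1 r.2 * (p.1 * r.1 == r.2 * p.2)%g%:R *
          (overlap k' s.1 s.2 * (p.1 * s.1 == s.2 * p.2)%g%:R))).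
      apply: eq_bigr => p _; rewrite /Fc pair_bigA /= expr2.
      rewrite [X in _ * X = _]mulr_suml [LHS]mulr_sumr.
      apply: eq_bigr => r _; rewrite [X in _ * X = _]mulr_sumr [LHS]mulr_sumr.
      by apply: eq_bigr.
    rewrite exchange_big /= [RHS]pair_bigA /=; apply: eq_bigr => r _.
    rewrite exchange_big /= [RHS]pair_bigA /=; apply: eq_bigr => s _.
    by rewrite pair_bigA /= [RHS]mulr_sumr; apply: eq_bigr => p _; ring.
  apply: le_trans (_ : \sum_v \sum_v' \sum_t \sum_t' overlap k' v v' * overlap k' t t' *
      (c ^+ 2 * (cap (t * v^-1)%g)%:R) <= _).
    do 4 (apply: ler_sum => ? _).
    by rewrite ler_wpM2l ?mulr_ge0 ?overlap_ge0 //; exact: inner_le.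
  apply: le_trans (_ : \sum_v \sum_t c ^+ 4 * (c ^+ 2 * (cap (t * v^-1)%g)%:R) <= _).
    apply: ler_sum => v _; rewrite exchange_big /=; apply: ler_sum => t _.
    under eq_bigr do rewrite -mulr_suml -mulr_sumr.
    rewrite -!mulr_suml ler_wpM2r ?mulr_ge0 ?sqr_ge0 ?ler0n //.
    rewrite (_ : c ^+ 4 = c ^+ 2 * c ^+ 2); last by ring.
    by rewrite ler_pM ?overlap_sum //; apply: sumr_ge0 => x _; exact: overlap_ge0.
  rewrite [leLHS](_ : _ = \sum_(v : G) c ^+ 6 * (\sum_b cap b)%:R).
    by rewrite sumr_const -[leLHS]mulr_natl mulrA.
  apply: eq_bigr => v _; rewrite natr_sum mulr_sumr (reindex_inj (mulIg v)) /=.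
  by apply: eq_bigr => t _; rewrite mulgK; ring.
apply: le_trans (ler_pM _ _ h1 h2) _.
- by apply: sumr_ge0 => p _; exact: overlap_ge0.
- by apply: sumr_ge0 => p _; rewrite mulr_ge0 ?sqr_ge0 ?overlap_ge0.
rewrite le_eqVlt; apply/orP; left; apply/eqP; ring.
Qed.

End Collision.

Section ProdRep.
Variables (R : rcfType) (N : nat).

Lemma orep_prod (H K : finGroupType) (A : H -> 'M[R]_N) (B : K -> 'M[R]_N) :
  orep A -> orep B -> (forall x y, A x *m B y = B y *m A x) ->
  orep (fun p : H * K => A p.1 *m B p.2).
Proof.
move=> hA hB c; split=> [x y|x|] /=.
- by rewrite (orepM hA) (orepM hB) -!mulmxA; congr (_ *m _); rewrite (mulmxCA _ (c _ _)).
- by rewrite trmx_mul (orepV hA) (orepV hB) c.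
- by rewrite (orep1 hA) (orep1 hB) mul1mx.
Qed.

Lemma gram_orep (H : finGroupType) (rho : H -> 'M[R]_N) (a : H -> R) : orep rho ->
  (\sum_p a p *: rho p)^T *m (\sum_p a p *: rho p) =
  \sum_r (\sum_p a p * a (p * r)%g) *: rho r.
Proof.
move=> h; rewrite [X in X *m _]linear_sum mulmx_suml /=.
under [RHS]eq_bigr do rewrite scaler_suml.
rewrite [RHS]exchange_big; apply: eq_bigr => p _ /=.
rewrite mulmx_sumr (reindex_inj (mulgI p)); apply: eq_bigr => r _.
have -> : (a p *: rho p)^T = a p *: rho p^-1%g by rewrite linearZ /= (orepV h).
by rewrite -scalemxAl -scalemxAr scalerA -(orepM h) mulKg.
Qed.

End ProdRep.

(** * The convolution operator and its majorants *)

Section Operator.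
Variables (R : rcfType) (N : nat) (G : finGroupType).
Variables (L0 L1 L2 : G -> 'M[R]_N).
Hypotheses (L0P : orep L0) (L1P : orep L1) (L2P : orep L2).
Hypothesis c01 : forall g h, L0 g *m L1 h = L1 h *m L0 g.
Hypothesis c02 : forall g h, L0 g *m L2 h = L2 h *m L0 g.
Hypothesis c12 : forall g h, L1 g *m L2 h = L2 h *m L1 g.
Local Notation n := (#|G|%:R : R).

Definition L3 (p : G * G * G) := L0 p.1.1 *m L1 p.1.2 *m L2 p.2.

Lemma L3P : orep L3.
Proof.
apply: (orep_prod (orep_prod L0P L1P c01) L2P) => -[x y] z /=.
by rewrite -mulmxA c12 !mulmxA c02.
Qed.

Variable m : R.
Hypothesis trL3 : forall p, \tr (L3 p) = m * (p == 1%g)%:R.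

Lemma trL3V p r : \tr (L3 p *m (L3 r)^T) = m * (p == r)%:R.
Proof.
rewrite (orepV L3P) -(orepM L3P) trL3; congr (_ * _%:R).
by rewrite -eq_mulgV1.
Qed.

Variable mu : G -> G -> G -> R.
Hypothesis mu0 : forall a b c, 0 <= mu a b c.

Definition opT := \sum_a \sum_b \sum_c mu a b c *: (L0 a *m L1 b *m L2 c).
Definition opP := opT^T *m opT.

(** The factor [n] is the price of Cauchy-Schwarz over the [n] values of the shared coordinate. *)
Definition ker0 x w := n * \sum_a \sum_b \sum_c mu a b c * mu a (b * x)%g (c * w)%g.
Definition ker1 x w := n * \sum_a \sum_b \sum_c mu a b c * mu (a * x)%g b (c * w)%g.
Definition opK0 := \sum_x \sum_w ker0 x w *: (L1 x *m L2 w).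
Definition opK1 := \sum_x \sum_w ker1 x w *: (L0 x *m L2 w).

Let X0 a := \sum_b \sum_c mu a b c *: (L1 b *m L2 c).
Let X1 b := \sum_a \sum_c mu a b c *: (L0 a *m L2 c).

Lemma opK0E : opK0 = n *: \sum_a (X0 a)^T *m X0 a.
Proof.
have h a : (X0 a)^T *m X0 a = \sum_x \sum_w
    (\sum_b \sum_c mu a b c * mu a (b * x)%g (c * w)%g) *: (L1 x *m L2 w).
  rewrite /X0 pair_bigA /=.
  rewrite (gram_orep (fun p => mu a p.1 p.2) (orep_prod L1P L2P c12)) pair_bigA.
  by apply: eq_bigr => p _; rewrite pair_bigA.
under [in RHS]eq_bigr do rewrite h.
rewrite exchange_big scaler_sumr; apply: eq_bigr => x _ /=.
rewrite exchange_big scaler_sumr; apply: eq_bigr => w _ /=.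
by rewrite -scaler_suml scalerA.
Qed.

Lemma opK1E : opK1 = n *: \sum_b (X1 b)^T *m X1 b.
Proof.
have h b : (X1 b)^T *m X1 b = \sum_x \sum_w
    (\sum_a \sum_c mu a b c * mu (a * x)%g b (c * w)%g) *: (L0 x *m L2 w).
  rewrite /X1 pair_bigA /=.
  rewrite (gram_orep (fun p => mu p.1 b p.2) (orep_prod L0P L2P c02)) pair_bigA.
  by apply: eq_bigr => p _; rewrite pair_bigA.
under [in RHS]eq_bigr do rewrite h.
rewrite exchange_big scaler_sumr; apply: eq_bigr => x _ /=.
rewrite exchange_big scaler_sumr; apply: eq_bigr => w _ /=.
by rewrite -scaler_suml scalerA /ker1 exchange_big.
Qed.

(** Grouping [opT] by its first coordinate gives a sum of [n] terms [L0 a *m X0 a]. Cauchy-Schwarz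
    is [psdq_gram], and the isometry [L0 a] drops out of each Gram matrix. *)
Lemma psdq_K0 : psdq (opK0 - opP).
Proof.
have e : opT = \sum_a L0 a *m X0 a.
  apply: eq_bigr => a _; rewrite mulmx_sumr; apply: eq_bigr => b _.
  by rewrite mulmx_sumr; apply: eq_bigr => c _; rewrite -scalemxAr mulmxA.
have e2 : \sum_a (X0 a)^T *m X0 a = \sum_a (L0 a *m X0 a)^T *m (L0 a *m X0 a).
  apply: eq_bigr => a _.
  by rewrite trmx_mul -mulmxA (mulmxA (L0 a)^T) (orep_isom L0P) mul1mx.
rewrite /opP opK0E e e2; exact: psdq_gram.
Qed.

Lemma psdq_K1 : psdq (opK1 - opP).
Proof.
have e : opT = \sum_b L1 b *m X1 b.
  rewrite /opT exchange_big; apply: eq_bigr => b _ /=.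
  rewrite mulmx_sumr; apply: eq_bigr => a _.
  by rewrite mulmx_sumr; apply: eq_bigr => c _; rewrite -scalemxAr mulmxA c01.
have e2 : \sum_a (X1 a)^T *m X1 a = \sum_a (L1 a *m X1 a)^T *m (L1 a *m X1 a).
  apply: eq_bigr => a _.
  by rewrite trmx_mul -mulmxA (mulmxA (L1 a)^T) (orep_isom L1P) mul1mx.
rewrite /opP opK1E e e2; exact: psdq_gram.
Qed.

Lemma gram_sym (I : finType) (c : R) (X : I -> 'M[R]_N) :
  (c *: \sum_i (X i)^T *m X i)^T = c *: \sum_i (X i)^T *m X i.
Proof.
rewrite linearZ linear_sum /=; congr (_ *: _).
by apply: eq_bigr => i _; rewrite trmx_mul trmxK.
Qed.

Lemma opP_sym : opP^T = opP.
Proof. by rewrite /opP trmx_mul trmxK. Qed.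

(** [opK0] acts through coordinates 1 and 2, [opK1] through 0 and 2. Hence both [opK0 *m opK1] and
    [opK1 *m opK0] expand over translations by (y, x, third), with third equal to [w v] in one and
    [v w] in the other. Orthogonality of translations under the trace forces equal x and y, which
    turns the kernels into overlaps, and leaves the equation [w v = v' w']. *)
Lemma trace_opP4_le : \tr (opP *m opP *m opP *m opP) <= m * collision ker0 ker1.
Proof.
have s0 : opK0^T = opK0 by rewrite opK0E gram_sym.
have s1 : opK1^T = opK1 by rewrite opK1E gram_sym.
apply: le_trans (trace_pow4_le opP_sym s0 _ _ _ psdq_K0 psdq_K1) _.
- exact: sos_sqr.
- by rewrite opK0E; apply: sos_gram.
- by rewrite opK1E; apply: sos_gram.
rewrite le_eqVlt; apply/orP; left; apply/eqP.
have -> : opK0 *m opK1 *m opK0 *m opK1 = opK0 *m opK1 *m (opK1 *m opK0)^T.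
  by rewrite trmx_mul s0 s1 mulmxA.
have eA : opK0 *m opK1 = \sum_(p : G * G) \sum_(r : G * G)
    (ker0 p.1 r.1 * ker1 p.2 r.2) *: L3 (p.2, p.1, (r.1 * r.2)%g).
  rewrite -(pair_bigA _ (fun x y => \sum_(r : G * G)
    (ker0 x r.1 * ker1 y r.2) *: L3 (y, x, (r.1 * r.2)%g))) /=.
  rewrite /opK0 mulmx_suml; apply: eq_bigr => x _.
  rewrite mulmx_sumr; apply: eq_bigr => y _.
  rewrite mulmx_suml -(pair_bigA _ (fun w v =>
    (ker0 x w * ker1 y v) *: L3 (y, x, (w * v)%g))) /=; apply: eq_bigr => w _.
  rewrite mulmx_sumr; apply: eq_bigr => v _.
  rewrite -scalemxAl -scalemxAr scalerA; congr (_ *: _).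
  by rewrite /L3 /= (orepM L2P) -!mulmxA -(mulmxCA _ (c02 _ _)) -(mulmxCA _ (c01 _ _)).
have eB : opK1 *m opK0 = \sum_(p : G * G) \sum_(r : G * G)
    (ker0 p.1 r.1 * ker1 p.2 r.2) *: L3 (p.2, p.1, (r.2 * r.1)%g).
  rewrite -(pair_bigA _ (fun x y => \sum_(r : G * G)
    (ker0 x r.1 * ker1 y r.2) *: L3 (y, x, (r.2 * r.1)%g))) /=.
  rewrite /opK0 mulmx_sumr; apply: eq_bigr => x _.
  rewrite mulmx_suml; apply: eq_bigr => y _.
  rewrite mulmx_sumr -(pair_bigA _ (fun w v =>
    (ker0 x w * ker1 y v) *: L3 (y, x, (v * w)%g))) /=; apply: eq_bigr => w _.
  rewrite mulmx_suml; apply: eq_bigr => v _.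
  rewrite -scalemxAl -scalemxAr scalerA mulrC; congr (_ *: _).
  by rewrite /L3 /= (orepM L2P) -!mulmxA -(mulmxCA _ (c12 _ _)).
rewrite eA eB linear_sum /= mulmx_suml raddf_sum /=.
transitivity (\sum_(p : G * G) \sum_(r : G * G) \sum_(s : G * G)
   m * (ker0 p.1 r.1 * ker1 p.2 r.2 * (ker0 p.1 s.1 * ker1 p.2 s.2) *
     (r.1 * r.2 == s.2 * s.1)%g%:R)).
  apply: eq_bigr => p _; rewrite mulmx_suml raddf_sum; apply: eq_bigr => r _ /=.
  rewrite mulmx_sumr raddf_sum (bigD1 p) //= [X in _ + X]big1 ?addr0.
    rewrite linear_sum mulmx_sumr raddf_sum; apply: eq_bigr => s _ /=.
    rewrite linearZ /= -scalemxAl -scalemxAr !mxtraceZ trL3V.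
    rewrite (_ : ((p.2, p.1, (r.1 * r.2)%g) == (p.2, p.1, (s.2 * s.1)%g)) =
      (r.1 * r.2 == s.2 * s.1)%g); first by ring.
    by rewrite !xpair_eqE !eqxx.
  move=> p' pp'; rewrite linear_sum mulmx_sumr raddf_sum big1 // => s _ /=.
  rewrite linearZ /= -scalemxAl -scalemxAr !mxtraceZ trL3V.
  rewrite (_ : (_ == _) = false) ?mulr0 //; apply: contraNF pp' => /eqP[e1 e2 _].
  by apply/eqP; case: p p' e1 e2 => ? ? [? ?] /= -> ->.
rewrite /collision mulr_sumr.
transitivity (\sum_w \sum_w' \sum_v \sum_v' \sum_(p : G * G)
  m * (ker0 p.1 w * ker1 p.2 v * (ker0 p.1 w' * ker1 p.2 v') *
     (w * v == v' * w')%g%:R)).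
  rewrite exchange_big /= -(pair_bigA _ (fun w v => \sum_p \sum_s
   m * (ker0 p.1 w * ker1 p.2 v * (ker0 p.1 s.1 * ker1 p.2 s.2) *
     (w * v == s.2 * s.1)%g%:R))) /=.
  apply: eq_bigr => w _; rewrite [RHS]exchange_big /=; apply: eq_bigr => v _.
  by rewrite exchange_big /= [RHS]pair_bigA.
apply: eq_bigr => w _; rewrite mulr_sumr; apply: eq_bigr => w' _.
rewrite !mulr_sumr; apply: eq_bigr => v _; rewrite !mulr_sumr; apply: eq_bigr => v' _.
rewrite /overlap -(pair_bigA _ (fun x y => m * (ker0 x w * ker1 y v * (ker0 x w' * ker1 y v') *
     (w * v == v' * w')%g%:R))) /=.
rewrite mulr_suml mulr_sumr; apply: eq_bigr => x _.
rewrite mulr_suml !mulr_sumr; apply: eq_bigr => y _; ring.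
Qed.

Variable c1 : R.
Hypothesis mu1 : \sum_a \sum_b \sum_c mu a b c <= 1.
Hypothesis mu01 : forall a b, \sum_c mu a b c <= c1.
Hypothesis mu02 : forall a c, \sum_b mu a b c <= c1.
Hypothesis mu12 : forall b c, \sum_a mu a b c <= c1.

Lemma c1_ge0 : 0 <= c1.
Proof. by apply: le_trans (mu01 1%g 1%g); apply: sumr_ge0. Qed.

(** The place where pairwise goodness enters: once the first sample is fixed, the second has two
    prescribed coordinates, and the sum over its third is a pair marginal. *)
Lemma ker_sum_le (h : G -> G -> G -> G -> R) :
  (forall a b c, \sum_x h a b c x <= c1) ->
  \sum_x n * \sum_a \sum_b \sum_c mu a b c * h a b c x <= n * c1.
Proof.
move=> hh; rewrite -mulr_sumr ler_wpM2l //.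
rewrite exchange_big; under eq_bigr do rewrite exchange_big.
under eq_bigr do under eq_bigr do rewrite exchange_big.
apply: le_trans (_ : \sum_a \sum_b \sum_c mu a b c * c1 <= _).
  by do 3 (apply: ler_sum => ? _); rewrite -mulr_sumr ler_wpM2l.
under eq_bigr do under eq_bigr do rewrite -mulr_suml.
under eq_bigr do rewrite -mulr_suml.
by rewrite -mulr_suml ler_piMl // c1_ge0.
Qed.

Lemma ker0_ge0 x w : 0 <= ker0 x w.
Proof. by rewrite mulr_ge0 //; do 3 (apply: sumr_ge0 => ? _); rewrite mulr_ge0. Qed.

Lemma ker1_ge0 x w : 0 <= ker1 x w.
Proof. by rewrite mulr_ge0 //; do 3 (apply: sumr_ge0 => ? _); rewrite mulr_ge0. Qed.

Lemma sum_mulg_le (h : G -> R) x : \sum_w h w <= c1 -> \sum_w h (x * w)%g <= c1.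
Proof. by rewrite (reindex_inj (mulgI x)). Qed.

Variable cap : G -> nat.
Hypothesis capP : forall a b, (#|[set w : G | (a * w == w * b)%g]| <= cap b)%N.
Hypothesis m_ge0 : 0 <= m.

Lemma trace_opP4_sqr_le :
  \tr (opP *m opP *m opP *m opP) ^+ 2 <=
  m ^+ 2 * (n ^+ 2 * (n * c1) ^+ 8 * (\sum_b cap b)%:R).
Proof.
have t0 : 0 <= \tr (opP *m opP *m opP *m opP).
  by have := trace_ge0 (opP *m opP); rewrite trmx_mul opP_sym mulmxA.
apply: le_trans (_ : (m * collision ker0 ker1) ^+ 2 <= _).
  rewrite ler_sqr ?nnegrE //; first exact: trace_opP4_le.
  by rewrite mulr_ge0 // collision_ge0 //; [exact: ker0_ge0 | exact: ker1_ge0].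
rewrite exprMn ler_wpM2l ?sqr_ge0 //; apply: collision_sqr_le => //.
- exact: ker0_ge0.
- exact: ker1_ge0.
- by move=> x; apply: ker_sum_le => a b c; apply: sum_mulg_le.
- by move=> w; apply: ker_sum_le => a b c; apply: (sum_mulg_le (h := fun y => mu a y _)).
- by move=> x; apply: ker_sum_le => a b c; apply: sum_mulg_le.
- by move=> w; apply: ker_sum_le => a b c; apply: (sum_mulg_le (h := fun y => mu y b _)).
Qed.

End Operator.

(** * Contraction *)

Section Marginal.
Variables (R : rcfType) (N : nat) (G : finGroupType).
Variables (A B D : G -> 'M[R]_N) (E : 'M[R]_N).
Hypotheses (AP : orep A) (BP : orep B) (DP : orep D) (EP : proj E).
Hypothesis ABD : avg A *m avg B *m avg D = E.
Variables (nu : G -> G -> G -> R) (eps : R).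
Local Notation n := (#|G|%:R : R).
Hypothesis nuP : forall b c, `|\sum_d nu b c d - n ^- 2| <= eps / n ^+ 2.

(** After averaging over one coordinate only the pair marginal of [nu] is seen. Its uniform part is
    a multiple of the projection [E], killed by [1%:M - E], and the deviations have total mass at
    most [eps]. *)
Lemma opn_marginal : opn (eps ^+ 2)
  ((\sum_b \sum_c \sum_d nu b c d *: (A b *m B c *m D d)) *m avg D *m (1%:M - E)).
Proof.
have n0 : n != 0 := cardG_neq0 R G.
have -> : (\sum_b \sum_c \sum_d nu b c d *: (A b *m B c *m D d)) *m avg D *m (1%:M - E) =
    \sum_(p : G * G) (\sum_d nu p.1 p.2 d - n ^- 2) *: (A p.1 *m B p.2 *m avg D *m (1%:M - E)).
  under [RHS]eq_bigr do rewrite scalerBl.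
  rewrite big_split /= sumrN -scaler_sumr -[X in _ *: X](pair_bigA _ (fun b c =>
    A b *m B c *m avg D *m (1%:M - E))) /=.
  have -> : n ^- 2 *: (\sum_b \sum_c A b *m B c *m avg D *m (1%:M - E)) =
      avg A *m avg B *m avg D *m (1%:M - E).
    move: (avg D) => eD; rewrite /avg -!scalemxAl -scalemxAr -!scalemxAl scalerA.
    rewrite -invrM ?unitfE // -expr2; congr (_ *: _).
    rewrite 3!mulmx_suml; apply: eq_bigr => b _.
    by rewrite mulmx_sumr 2!mulmx_suml.
  rewrite ABD (_ : E *m (1%:M - E) = 0) ?subr0; last by rewrite mulmxBr mulmx1 EP.1 subrr.
  rewrite -(pair_bigA _ (fun b c => (\sum_d nu b c d) *: (A b *m B c *m avg D *m (1%:M - E)))) /=.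
  rewrite 2!mulmx_suml; apply: eq_bigr => b _.
  rewrite 2!mulmx_suml; apply: eq_bigr => c _.
  rewrite 2!mulmx_suml scaler_suml; apply: eq_bigr => d _.
  by rewrite -!scalemxAl -(mulmxA _ (D d)) (mul_avg DP).
have hU p : opn 1 (A p.1 *m B p.2 *m avg D *m (1%:M - E)).
  exact: opn1_mul (opn1_mul (opn1_mul (opn_orep AP _) (opn_orep BP _))
    (opn_proj (proj_avg DP))) (opn_proj (projC EP)).
apply: opn_le (opn_wsum _ hU).
have e0 : 0 <= eps.
  have := le_trans (normr_ge0 _) (nuP 1%g 1%g).
  by rewrite pmulr_lge0 // invr_gt0 exprn_gt0 // lt0r n0 ler0n.
rewrite ler_sqr ?nnegrE ?sumr_ge0 //.
apply: le_trans (_ : \sum_(p : G * G) eps / n ^+ 2 <= _).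
  by apply: ler_sum => p _.
rewrite sumr_const card_prod -[leLHS]mulr_natl natrM.
by rewrite le_eqVlt; apply/orP; left; apply/eqP; field.
Qed.

End Marginal.

Definition avg3 (R : rcfType) N (G : finGroupType) (L0 L1 L2 : G -> 'M[R]_N) :=
  avg L0 *m avg L1 *m avg L2.

Lemma comm_avg2 (R : rcfType) N (G H : finGroupType) (A : G -> 'M[R]_N) (B : H -> 'M[R]_N) :
  (forall g h, A g *m B h = B h *m A g) -> avg A *m avg B = avg B *m avg A.
Proof. by move=> c; apply: comm_avg => x; apply: orep_comm_avg. Qed.

Section Avg3.
Variables (R : rcfType) (N : nat) (G : finGroupType) (L0 L1 L2 : G -> 'M[R]_N).
Hypotheses (L0P : orep L0) (L1P : orep L1) (L2P : orep L2).
Hypothesis c01 : forall g h, L0 g *m L1 h = L1 h *m L0 g.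
Hypothesis c02 : forall g h, L0 g *m L2 h = L2 h *m L0 g.
Hypothesis c12 : forall g h, L1 g *m L2 h = L2 h *m L1 g.

Lemma proj_avg3 : proj (avg3 L0 L1 L2).
Proof.
have [E0i E0t] := proj_avg L0P; have [E1i E1t] := proj_avg L1P.
have [E2i E2t] := proj_avg L2P.
have e01 := comm_avg2 c01; have e02 := comm_avg2 c02; have e12 := comm_avg2 c12.
split; last first.
  by rewrite /avg3 !trmx_mul E0t E1t E2t -e01 (mulmxCA _ (esym e02)) -e12 mulmxA.
rewrite /avg3 -!mulmxA -(mulmxCA _ e02) -(mulmxCA _ e01) (mulmxA (avg L0) (avg L0)) E0i.
by rewrite -(mulmxCA _ e12) (mulmxA (avg L1) (avg L1)) E1i E2i.
Qed.

End Avg3.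

Section Contraction.
Variables (R : rcfType) (N : nat) (F : finFieldType).
Local Notation q := (#|F|%:R : R).
Local Notation G := (SL2 F).
Local Notation n := (#|G|%:R : R).
Variables (L0 L1 L2 r0 r1 r2 : G -> 'M[R]_N).
Hypotheses (L0P : orep L0) (L1P : orep L1) (L2P : orep L2).
Hypotheses (r0P : orep r0) (r1P : orep r1) (r2P : orep r2).
Hypothesis c01 : forall g h, L0 g *m L1 h = L1 h *m L0 g.
Hypothesis c02 : forall g h, L0 g *m L2 h = L2 h *m L0 g.
Hypothesis c12 : forall g h, L1 g *m L2 h = L2 h *m L1 g.
Hypothesis d01 : forall g h, r0 g *m r1 h = r1 h *m r0 g.
Hypothesis d02 : forall g h, r0 g *m r2 h = r2 h *m r0 g.
Hypothesis d12 : forall g h, r1 g *m r2 h = r2 h *m r1 g.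
Hypothesis rL0 : forall p g, r0 g *m L3 L0 L1 L2 p = L3 L0 L1 L2 p *m r0 g.
Hypothesis rL1 : forall p g, r1 g *m L3 L0 L1 L2 p = L3 L0 L1 L2 p *m r1 g.
Hypothesis rL2 : forall p g, r2 g *m L3 L0 L1 L2 p = L3 L0 L1 L2 p *m r2 g.
Hypotheses (a0 : avg L0 = avg r0) (a1 : avg L1 = avg r1) (a2 : avg L2 = avg r2).
Hypothesis trL3 : forall p, \tr (L3 L0 L1 L2 p) = n ^+ 3 * (p == 1%g)%:R.

Variable mu : G -> G -> G -> R.
Hypothesis mu0 : forall a b c, 0 <= mu a b c.
Hypothesis mu1 : \sum_a \sum_b \sum_c mu a b c = 1.
Variable eps : R.
Hypothesis mu01 : forall a b, `|\sum_c mu a b c - n ^- 2| <= eps / n ^+ 2.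
Hypothesis mu02 : forall a c, `|\sum_b mu a b c - n ^- 2| <= eps / n ^+ 2.
Hypothesis mu12 : forall b c, `|\sum_a mu a b c - n ^- 2| <= eps / n ^+ 2.
Hypothesis eps_le : eps ^+ 2 <= q^-1.

Local Notation T := (opT L0 L1 L2 mu).
Local Notation P := (opP L0 L1 L2 mu).
Local Notation E0 := (avg L0).
Local Notation E1 := (avg L1).
Local Notation E2 := (avg L2).

Local Notation opE := (avg3 L0 L1 L2).

Let n_gt0 : 0 < n. Proof. by rewrite lt0r (cardG_neq0 R G) ler0n. Qed.
Let q_gt1' : 1 < q. Proof. exact: q_gt1. Qed.
Let q_gt0 : 0 < q. Proof. exact: lt_trans ltr01 q_gt1'. Qed.

Let eps_le1 : eps <= 1.
Proof.
rewrite leNgt; apply/negP => h.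
have : 1 < eps ^+ 2 by rewrite exprn_egt1.
apply/negP; rewrite -leNgt; apply: le_trans eps_le _.
by rewrite invf_le1 // ltW.
Qed.

Let marg_le x : `|x - n ^- 2| <= eps / n ^+ 2 -> x <= 2 / n ^+ 2.
Proof.
rewrite ler_norml => /andP[_ h].
have : eps / n ^+ 2 <= 1 / n ^+ 2 by rewrite ler_wpM2r // invr_ge0 exprn_ge0 // ltW.
lra.
Qed.

Lemma opT_sum3 : T = \sum_(p : G * G * G) mu p.1.1 p.1.2 p.2 *: L3 L0 L1 L2 p.
Proof. by rewrite (sum_triple (fun p => mu p.1.1 p.1.2 p.2 *: L3 L0 L1 L2 p)). Qed.

Lemma opn1_T : opn 1 T.
Proof.
rewrite opT_sum3; apply: opn_le (opn_wsum (fun p => mu p.1.1 p.1.2 p.2)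
  (fun p => opn_orep (L3P L0P L1P L2P c01 c02 c12) p)).
rewrite (sum_triple (fun p => `|mu p.1.1 p.1.2 p.2|)) /=.
under eq_bigr do under eq_bigr do under eq_bigr do rewrite ger0_norm //.
by rewrite mu1 expr1n.
Qed.

Lemma comm_T (A : 'M[R]_N) : (forall p, A *m L3 L0 L1 L2 p = L3 L0 L1 L2 p *m A) ->
  A *m T = T *m A.
Proof.
move=> h; rewrite opT_sum3 mulmx_sumr mulmx_suml; apply: eq_bigr => p _.
by rewrite -scalemxAr -scalemxAl h.
Qed.

Lemma comm_rep_PP (r : G -> 'M[R]_N) : orep r ->
  (forall p g, r g *m L3 L0 L1 L2 p = L3 L0 L1 L2 p *m r g) ->
  forall g, r g *m (P *m P) = P *m P *m r g.
Proof.
move=> rP h g.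
have hT x : r x *m T = T *m r x by apply: comm_T => p; exact: h.
have hTt x : r x *m T^T = T^T *m r x.
  apply: trmx_inj; rewrite !trmx_mul trmxK (orepV rP); exact: esym (hT _).
have hP : r g *m P = P *m r g by rewrite /opP mulmxA hTt -mulmxA hT mulmxA.
by rewrite mulmxA hP -mulmxA hP mulmxA.
Qed.

Lemma tr_P4_le : \tr (P *m P *m P *m P) ^+ 2 <= 512 * q ^+ 5.
Proof.
have c1 x y := marg_le (mu01 x y); have c2 x y := marg_le (mu02 x y).
have c3 x y := marg_le (mu12 x y).
apply: le_trans (trace_opP4_sqr_le L0P L1P L2P c01 c02 c12 trL3 mu0 _ c1 c2 c3
  (@card_intertwiner_le F) _) _; first by rewrite mu1.
  by rewrite exprn_ge0 // ltW.
have := sum_inter_bound F; rewrite -(ler_nat R).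
set S := (\sum_b inter_bound b)%:R => hS.
(* The trace of the identity is [n ^+ 3] and pair marginals are at most [2 / n ^+ 2], so all powers
   of [n] cancel and 2^8 remains. *)
have -> : (n ^+ 3) ^+ 2 * (n ^+ 2 * (n * (2 / n ^+ 2)) ^+ 8 * S) = 256 * S.
  by field; rewrite lt0r_neq0.
have hn : n <= q ^+ 3 by rewrite -natrX ler_nat; exact: card_SL2_le.
have hS2 : S <= 2 * q ^+ 5.
  apply: le_trans hS _; rewrite natrM natrM natrX ler_wpM2l //.
  by rewrite (exprD q 3 2) ler_wpM2r // sqr_ge0.
lra.
Qed.

Lemma PP_bound f : E0 *m f = 0 -> E1 *m f = 0 -> E2 *m f = 0 ->
  nrm (P *m P *m f) ^+ 2 <= 2 ^+ 23 / q * nrm f ^+ 2.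
Proof.
move=> h0 h1 h2.
have TT := opn1_mul (opn_tr opn1_T) opn1_T.
have PP1 := opn1_mul TT TT.
rewrite a0 in h0; rewrite a1 in h1; rewrite a2 in h2.
have := quasirandom r0P r1P r2P d01 d02 d12 (comm_rep_PP r0P rL0)
  (comm_rep_PP r1P rL1) (comm_rep_PP r2P rL2) PP1 h0 h1 h2.
rewrite trmx_mul opP_sym [_ *m (P *m P)]mulmxA.
have ht := tr_P4_le.
have t0 : 0 <= \tr (P *m P *m P *m P).
  by have := trace_ge0 (P *m P); rewrite trmx_mul opP_sym mulmxA.
set t := \tr _ in ht t0 *; set y := nrm (P *m P *m f); set x := nrm f => hy.
have y0 : 0 <= y := nrm_ge0 _.
have x0 : 0 <= x := nrm_ge0 _.
have hb : (8 / (q - 1) ^+ 3 * t + 6 / q) <= 64 / q ^+ 3 * t + 6 / q.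
  rewrite lerD2r ler_wpM2r //.
  have -> : 64 / q ^+ 3 = 8 / (q / 2) ^+ 3 by field; rewrite lt0r_neq0.
  have p2 : 0 < q / 2 by rewrite divr_gt0.
  have q2 : 2 <= q by rewrite ler_nat; exact: card_finNzRing_gt1.
  have p3 : q / 2 <= q - 1 by lra.
  have p4 : 0 < q - 1 := lt_le_trans p2 p3.
  rewrite ler_wpM2l // lef_pV2 ?posrE ?exprn_gt0 //.
  by rewrite lerXn2r // nnegrE ltW.
have hy2 : y <= (64 / q ^+ 3 * t + 6 / q) * x.
  by apply: le_trans hy _; rewrite ler_wpM2r.
apply: le_trans (_ : ((64 / q ^+ 3 * t + 6 / q) * x) ^+ 2 <= _).
  by rewrite lerXn2r // nnegrE // mulr_ge0 // addr_ge0 // ?mulr_ge0 // ?invr_ge0 ?exprn_ge0 // ltW.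
rewrite exprMn ler_wpM2r ?sqr_ge0 //.
(* With the squared trace at most 512 q^5 = 2^9 q^5, the first square is 2^12 2^9 / q = 2^21 / q.
   The second is smaller, and 2 (2^21 + 2^21) = 2^23. *)
apply: le_trans (_ : 2 * ((64 / q ^+ 3 * t) ^+ 2 + (6 / q) ^+ 2) <= _).
  by have := sqr_ge0 (64 / q ^+ 3 * t - 6 / q); nra.
have e1 : (64 / q ^+ 3 * t) ^+ 2 <= 2 ^+ 21 / q.
  rewrite exprMn; apply: le_trans (ler_wpM2l (sqr_ge0 _) ht) _.
  by rewrite le_eqVlt; apply/orP; left; apply/eqP; field; rewrite lt0r_neq0.
have e2 : (6 / q) ^+ 2 <= 36 / q.
  rewrite exprMn (_ : 6 ^+ 2 = 36); last by ring.
  rewrite ler_wpM2l // expr2 ler_piMr ?invr_ge0 ?(ltW q_gt0) //.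
  by rewrite invf_le1 // ltW.
have i0 : 0 < q^-1 by rewrite invr_gt0.
have e3 : 36 / q <= 2 ^+ 21 / q.
  rewrite ler_wpM2r ?(ltW i0) //; apply: le_trans (_ : 2 ^+ 6 <= _).
    by rewrite -natrX ler_nat.
  by rewrite ler_eXn2l // (ltr_nat R 1 2).
have -> : 2 ^+ 23 / q = 4 * (2 ^+ 21 / q).
  by rewrite (exprD 2 2 21) -mulrA; congr (_ * _); rewrite -natrX.
lra.
Qed.

(** Two Cauchy-Schwarz steps, from [T] to [P = T^T T] and from [P] to [P *m P]. Each squares the
    quantity bounded, and a third squaring is already in [PP_bound], whence the exponent 8. *)
Lemma T_bound f : E0 *m f = 0 -> E1 *m f = 0 -> E2 *m f = 0 ->
  nrm (T *m f) ^+ 8 <= 2 ^+ 23 / q * nrm f ^+ 8.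
Proof.
move=> h0 h1 h2; have hP := PP_bound h0 h1 h2.
have x0 := nrm_ge0 f; have t0 := nrm_ge0 (T *m f); have p0 := nrm_ge0 (P *m f).
have e1 : nrm (T *m f) ^+ 2 <= nrm f * nrm (P *m f).
  apply: le_trans (dot_sqr_le f (P *m f)).
  by rewrite /opP -mulmxA dot_mulr trmxK.
have e2 : nrm (P *m f) ^+ 2 <= nrm f * nrm (P *m P *m f).
  apply: le_trans (dot_sqr_le f (P *m P *m f)).
  by rewrite -mulmxA [dot f _]dot_mulr opP_sym.
apply: le_trans (_ : (nrm f * nrm (P *m f)) ^+ 4 <= _).
  by rewrite (exprM _ 2 4) lerXn2r // nnegrE ?mulr_ge0 // exprn_ge0.
apply: le_trans (_ : nrm f ^+ 4 * (nrm f * nrm (P *m P *m f)) ^+ 2 <= _).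
  rewrite exprMn ler_wpM2l ?exprn_ge0 //.
  by rewrite (exprM _ 2 2) lerXn2r // nnegrE ?mulr_ge0 ?nrm_ge0 // exprn_ge0.
rewrite exprMn mulrA -exprD.
apply: le_trans (ler_wpM2l (exprn_ge0 6 x0) hP) _.
rewrite mulrCA -exprD //.
Qed.

Variable beta : R.
Hypothesis beta_ge0 : 0 <= beta.
Hypothesis betaE : beta ^+ 8 = 2 ^+ 23 / q.

Let E0P : proj E0 := proj_avg L0P.
Let E1P : proj E1 := proj_avg L1P.
Let E2P : proj E2 := proj_avg L2P.

Let e01 := comm_avg2 c01.
Let e02 := comm_avg2 c02.
Let e12 := comm_avg2 c12.

Lemma opn_nontrivial :
  opn beta (T *m ((1%:M - E0) *m (1%:M - E1) *m (1%:M - E2))).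
Proof.
set Q := _ *m _ *m _ => f.
have cm (A B : 'M[R]_N) : A *m B = B *m A -> A *m (1%:M - B) = (1%:M - B) *m A.
  by move=> h; rewrite mulmxBl mulmxBr h mul1mx mulmx1.
have z (A : 'M[R]_N) : proj A -> A *m (1%:M - A) = 0.
  by move=> h; rewrite mulmxBr mulmx1 h.1 subrr.
have q0 : E0 *m (Q *m f) = 0 by rewrite /Q !mulmxA z // !mul0mx.
have q1 : E1 *m (Q *m f) = 0.
  by rewrite /Q !mulmxA (cm E1) // -(mulmxA _ E1) z // mulmx0 !mul0mx.
have q2 : E2 *m (Q *m f) = 0.
  by rewrite /Q -!mulmxA (mulmxCA _ (cm E2 E0 _)) // (mulmxCA _ (cm E2 E1 _)) //
     (mulmxA E2) z // mul0mx !mulmx0.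
have b := T_bound q0 q1 q2.
have hQ : nrm (Q *m f) <= nrm f.
  have h := opn1_mul (opn1_mul (opn_proj (projC E0P)) (opn_proj (projC E1P)))
     (opn_proj (projC E2P)).
  by have := h f; rewrite mul1r.
rewrite -mulmxA; apply: le_trans (_ : beta * nrm (Q *m f) <= _); last by rewrite ler_wpM2l.
rewrite -(@ler_pXn2r _ 8) ?nnegrE ?nrm_ge0 ?mulr_ge0 ?nrm_ge0 //.
by rewrite exprMn betaE.
Qed.

Let eps_le_beta : eps ^+ 2 <= beta.
Proof.
apply: le_trans eps_le _.
have i0 : 0 <= q^-1 by rewrite invr_ge0 ltW.
have i1 : q^-1 <= 1 by rewrite invf_le1 // ltW.
rewrite -(@ler_pXn2r _ 8) ?nnegrE // betaE.
apply: le_trans (_ : q^-1 <= _).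
  by rewrite exprS ler_piMr // exprn_ile1.
by rewrite ler_peMl // exprn_ege1 // (ler_nat _ 1 2).
Qed.

Lemma opn_T : opn (16 * beta) (T *m (1%:M - opE)).
Proof.
have EP := proj_avg3 L0P L1P L2P c01 c02 c12.
have m0 : opn beta (T *m E0 *m (1%:M - opE)).
  apply: (opn_le eps_le_beta).
  have -> : T = \sum_b \sum_c \sum_a mu a b c *: (L1 b *m L2 c *m L0 a).
    rewrite /opT exchange_big; apply: eq_bigr => b _ /=.
    rewrite exchange_big; apply: eq_bigr => c _ /=; apply: eq_bigr => a _.
    by rewrite -[in RHS]mulmxA -c02 [in RHS]mulmxA -c01.
  apply: (opn_marginal L1P L2P L0P EP) => //.
  by rewrite -mulmxA -e02 mulmxA -e01.
have m1 : opn beta (T *m E1 *m (1%:M - opE)).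
  apply: (opn_le eps_le_beta).
  have -> : T = \sum_a \sum_c \sum_b mu a b c *: (L0 a *m L2 c *m L1 b).
    rewrite /opT; apply: eq_bigr => a _ /=.
    rewrite exchange_big; apply: eq_bigr => c _ /=; apply: eq_bigr => b _.
    by rewrite -!mulmxA c12.
  apply: (opn_marginal L0P L2P L1P EP) => //.
  by rewrite -mulmxA -e12 mulmxA.
have m2 : opn beta (T *m E2 *m (1%:M - opE)).
  apply: (opn_le eps_le_beta).
  exact: (opn_marginal L0P L1P L2P EP).
have cE0 : opE *m E0 = E0 *m opE.
  by rewrite /avg3 -mulmxA -e02 mulmxA -(mulmxA E0) -e01 mulmxA -!mulmxA.
have cE1 : opE *m E1 = E1 *m opE.
  by rewrite /avg3 -mulmxA -e12 -!mulmxA (mulmxCA _ e01).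
have cm (A B : 'M[R]_N) : A *m B = B *m A ->
    (1%:M - A) *m (1%:M - B) = (1%:M - B) *m (1%:M - A).
  move=> h; rewrite !mulmxBl !mulmxBr !mul1mx !mulmx1 h.
  by rewrite opprB opprB addrACA [_ - A]addrC addrACA.
have cm1 (A B : 'M[R]_N) : A *m B = B *m A -> A *m (1%:M - B) = (1%:M - B) *m A.
  by move=> h; rewrite mulmxBl mulmxBr h mul1mx mulmx1.
(* Split off the functions constant in coordinate 0, then in 1, then in 2. The first three pieces
   fall under the marginal bound, and the last has mean zero in every coordinate. *)
have split3 : 1%:M = E0 + E1 *m (1%:M - E0) + (E2 *m (1%:M - E0) *m (1%:M - E1) +
    (1%:M - E0) *m (1%:M - E1) *m (1%:M - E2)).
  rewrite (cm1 E2 E0 (esym e02)) -(mulmxA _ E2) (cm1 E2 E1 (esym e12)) mulmxA -mulmxDr.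
  rewrite [E2 + _]addrC subrK mulmx1 -addrA (cm1 E1 E0 (esym e01)) -mulmxDr.
  by rewrite [E1 + _]addrC subrK mulmx1 addrC subrK.
have -> : T *m (1%:M - opE) =
    (T *m E0 *m (1%:M - opE) + T *m E1 *m (1%:M - opE) *m (1%:M - E0)) +
    (T *m E2 *m (1%:M - opE) *m (1%:M - E0) *m (1%:M - E1) +
     T *m ((1%:M - E0) *m (1%:M - E1) *m (1%:M - E2)) *m (1%:M - opE)).
  move: (cm _ _ cE0) (cm _ _ cE1) split3.
  move: (1%:M - E0) (1%:M - E1) (1%:M - E2) (1%:M - opE) => x0 x1 x2 y k0 k1 s3.
  rewrite -[in LHS](mulmx1 T) s3 !mulmxDr !mulmxDl -!mulmxA.
  by rewrite k0 (mulmxCA _ k0) k1.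
(* Adding two operators costs a factor 2 in squared norm; the four pieces are added in a balanced
   tree. *)
have -> : 16 * beta = 2 * (2 * (beta + beta) + 2 * (beta + beta)) by ring.
have p0 := opn_proj (projC E0P); have p1 := opn_proj (projC E1P).
have pE := opn_proj (projC EP).
have om (A B : 'M[R]_N) : opn beta A -> opn 1 B -> opn beta (A *m B).
  by move=> hA hB; have := opn_mul beta_ge0 hA hB; rewrite mulr1.
exact: opn_add (opn_add m0 (om _ _ m1 p0))
  (opn_add (om _ _ (om _ _ m2 p0) p1) (om _ _ opn_nontrivial pE)).
Qed.

End Contraction.

(** * Translations on the cube of the group *)

Section FunMatrix.
Variables (R : rcfType) (X : finType).

Definition fmx (f : X -> X) : 'M[R]_#|X| :=
  \matrix_(i, j) (enum_val i == f (enum_val j))%:R.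

Lemma eq_fmx f g : f =1 g -> fmx f = fmx g.
Proof. by move=> h; apply/matrixP=> i j; rewrite !mxE h. Qed.

Lemma fmxM f g : fmx f *m fmx g = fmx (f \o g).
Proof.
apply/matrixP=> i j; rewrite !mxE (bigD1 (enum_rank (g (enum_val j)))) //=.
rewrite !mxE enum_rankK eqxx mulr1 big1 ?addr0 // => k hk.
rewrite !mxE (_ : (enum_val k == _) = false) ?mulr0 //.
by apply: contraNF hk => /eqP <-; rewrite enum_valK.
Qed.

Lemma fmx_tr f g : cancel f g -> cancel g f -> (fmx f)^T = fmx g.
Proof.
move=> fg gf; apply/matrixP=> i j; rewrite !mxE; congr _%:R.
by rewrite [in LHS]eq_sym (can2_eq fg gf) eq_sym.
Qed.

Lemma fmx_id : fmx id = 1%:M.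
Proof. by apply/matrixP=> i j; rewrite !mxE (inj_eq enum_val_inj). Qed.

Lemma tr_fmx f : \tr (fmx f) = (\sum_x (x == f x)%:R).
Proof.
rewrite /mxtrace (reindex enum_rank) /=; last first.
  by exists enum_val => x _; rewrite ?enum_rankK ?enum_valK.
by apply: eq_bigr => x _; rewrite mxE enum_rankK.
Qed.

End FunMatrix.

Section Regular.
Variables (R : rcfType) (G : finGroupType).
Local Notation X := (G * G * G)%type.
Local Notation n := (#|G|%:R : R).

Definition lact0 (g : G) : 'M[R]_#|{: X}| := fmx R (fun p : X => (g * p.1.1, p.1.2, p.2)%g).
Definition lact1 (g : G) : 'M[R]_#|{: X}| := fmx R (fun p : X => (p.1.1, g * p.1.2, p.2)%g).
Definition lact2 (g : G) : 'M[R]_#|{: X}| := fmx R (fun p : X => (p.1.1, p.1.2, g * p.2)%g).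
Definition ract0 (g : G) : 'M[R]_#|{: X}| := fmx R (fun p : X => (p.1.1 * g^-1, p.1.2, p.2)%g).
Definition ract1 (g : G) : 'M[R]_#|{: X}| := fmx R (fun p : X => (p.1.1, p.1.2 * g^-1, p.2)%g).
Definition ract2 (g : G) : 'M[R]_#|{: X}| := fmx R (fun p : X => (p.1.1, p.1.2, p.2 * g^-1)%g).

Ltac orep_fmx := split=> [x y|x|];
  [ by rewrite fmxM; apply: eq_fmx => -[[a b] c] /=; rewrite ?invMg ?mulgA
  | by apply: fmx_tr => -[[a b] c] /=; rewrite ?invgK ?mulKg ?mulKVg ?mulgK ?mulgKV
  | by rewrite -fmx_id; apply: eq_fmx => -[[a b] c] /=; rewrite ?invg1 ?mul1g ?mulg1 ].

Lemma lact0P : orep lact0. Proof. orep_fmx. Qed.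
Lemma lact1P : orep lact1. Proof. orep_fmx. Qed.
Lemma lact2P : orep lact2. Proof. orep_fmx. Qed.
Lemma ract0P : orep ract0. Proof. orep_fmx. Qed.
Lemma ract1P : orep ract1. Proof. orep_fmx. Qed.
Lemma ract2P : orep ract2. Proof. orep_fmx. Qed.

Ltac comm_fmx := by rewrite !fmxM; apply: eq_fmx => -[[a b] c] /=; rewrite ?mulgA.

Lemma lact01 g h : lact0 g *m lact1 h = lact1 h *m lact0 g. Proof. comm_fmx. Qed.
Lemma lact02 g h : lact0 g *m lact2 h = lact2 h *m lact0 g. Proof. comm_fmx. Qed.
Lemma lact12 g h : lact1 g *m lact2 h = lact2 h *m lact1 g. Proof. comm_fmx. Qed.
Lemma ract01 g h : ract0 g *m ract1 h = ract1 h *m ract0 g. Proof. comm_fmx. Qed.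
Lemma ract02 g h : ract0 g *m ract2 h = ract2 h *m ract0 g. Proof. comm_fmx. Qed.
Lemma ract12 g h : ract1 g *m ract2 h = ract2 h *m ract1 g. Proof. comm_fmx. Qed.

Definition lact := L3 lact0 lact1 lact2.

Lemma lactE p : lact p = fmx R (fun x : X => (p.1.1 * x.1.1, p.1.2 * x.1.2, p.2 * x.2)%g).
Proof. by rewrite /lact /L3 !fmxM; apply: eq_fmx => -[[a b] c]. Qed.

Lemma rl0 p g : ract0 g *m lact p = lact p *m ract0 g.
Proof. rewrite lactE; comm_fmx. Qed.
Lemma rl1 p g : ract1 g *m lact p = lact p *m ract1 g.
Proof. rewrite lactE; comm_fmx. Qed.
Lemma rl2 p g : ract2 g *m lact p = lact p *m ract2 g.
Proof. rewrite lactE; comm_fmx. Qed.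

(** Left and right translations have the same orbits on the coordinate, so the mean-zero conditions
    suited to [T] are also those of the right action used for quasirandomness. The substitution is
    the one solving [g x = x h^-1]. *)
Lemma avg_reg0 : avg lact0 = avg ract0.
Proof.
rewrite /avg; congr (_ *: _); apply/matrixP => i j; rewrite !summxE.
set x := (enum_val j).1.1.
rewrite (reindex_inj (inj_comp (mulgI x) (inj_comp (mulIg x^-1%g) (@invg_inj G)))) /=.
by apply: eq_bigr => g _; rewrite !mxE -/x mulgA mulgKV.
Qed.

Lemma avg_reg1 : avg lact1 = avg ract1.
Proof.
rewrite /avg; congr (_ *: _); apply/matrixP => i j; rewrite !summxE.
set x := (enum_val j).1.2.
rewrite (reindex_inj (inj_comp (mulgI x) (inj_comp (mulIg x^-1%g) (@invg_inj G)))) /=.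
by apply: eq_bigr => g _; rewrite !mxE -/x mulgA mulgKV.
Qed.

Lemma avg_reg2 : avg lact2 = avg ract2.
Proof.
rewrite /avg; congr (_ *: _); apply/matrixP => i j; rewrite !summxE.
set x := (enum_val j).2.
rewrite (reindex_inj (inj_comp (mulgI x) (inj_comp (mulIg x^-1%g) (@invg_inj G)))) /=.
by apply: eq_bigr => g _; rewrite !mxE -/x mulgA mulgKV.
Qed.

Lemma tr_lact p : \tr (lact p) = n ^+ 3 * (p == 1%g)%:R.
Proof.
rewrite lactE tr_fmx (eq_bigr (fun=> (p == 1%g)%:R)) => [|[[a b] c] _ /=].
  by rewrite sumr_const !card_prod -[LHS]mulr_natl !natrM; congr (_ * _); ring.
congr (nat_of_bool _)%:R; case: p => [[x y] z] /=.
apply/eqP/eqP => [[e1 e2 e3]|[-> -> ->]]; last by rewrite !mul1g.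
have -> : x = 1%g by apply: (mulIg a); rewrite mul1g -e1.
have -> : y = 1%g by apply: (mulIg b); rewrite mul1g -e2.
by have -> : z = 1%g by apply: (mulIg c); rewrite mul1g -e3.
Qed.

Lemma avg3_lact : avg3 lact0 lact1 lact2 = n ^- 3 *: \sum_p lact p.
Proof.
rewrite /avg3 /avg -!scalemxAl -!scalemxAr -!scalemxAl !scalerA.
rewrite sum_triple; congr (_ *: _); first by field; exact: cardG_neq0.
rewrite 2!mulmx_suml; apply: eq_bigr => x _.
rewrite [X in X *m _]mulmx_sumr mulmx_suml; apply: eq_bigr => y _.
by rewrite mulmx_sumr.
Qed.

Lemma lact_avg3 p : lact p *m avg3 lact0 lact1 lact2 = avg3 lact0 lact1 lact2.
Proof.
have h := L3P lact0P lact1P lact2P lact01 lact02 lact12.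
rewrite avg3_lact -scalemxAr mulmx_sumr; congr (_ *: _).
rewrite [RHS](reindex_inj (mulgI p)); apply: eq_bigr => r _.
by rewrite -(orepM h).
Qed.

Lemma lact_avg3C p : avg3 lact0 lact1 lact2 *m lact p = lact p *m avg3 lact0 lact1 lact2.
Proof.
have h := L3P lact0P lact1P lact2P lact01 lact02 lact12.
rewrite lact_avg3 avg3_lact -scalemxAl mulmx_suml; congr (_ *: _).
rewrite [RHS](reindex_inj (mulIg p)); apply: eq_bigr => r _.
by rewrite -(orepM h).
Qed.

(** Exactly one translation joins two given points, so the projection onto constants has all entries
    equal. *)
Lemma avg3_entry i j : avg3 lact0 lact1 lact2 i j = n ^- 3.
Proof.
rewrite avg3_lact mxE summxE.
rewrite (bigD1 (enum_val i * (enum_val j)^-1)%g) //= lactE mxE.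
rewrite big1 ?addr0 => [|p hp].
  rewrite (_ : _ == _) ?mulr1 //.
  by case: (enum_val i) (enum_val j) => [[a b] c] [[a' b'] c'] /=; rewrite !mulgKV.
rewrite lactE mxE; apply/eqP; rewrite pnatr_eq0 eqb0; apply: contraNN hp => /eqP ->.
by apply/eqP; case: (enum_val j) p => [[a b] c] [[a' b'] c'];
   congr (_, _, _); rewrite /= mulgK.
Qed.

End Regular.

(** * From operators back to distributions *)

Section Tuples.
Variables (R : rcfType) (G : finGroupType).
Local Notation X := (G * G * G)%type.
Local Notation tup := (tupG G 3).
Local Notation n := (#|G|%:R : R).

Definition i0 : 'I_3 := Ordinal (isT : 0 < 3)%N.
Definition i1 : 'I_3 := Ordinal (isT : 1 < 3)%N.
Definition i2 : 'I_3 := Ordinal (isT : 2 < 3)%N.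

Lemma ord3P (P : 'I_3 -> Prop) : P i0 -> P i1 -> P i2 -> forall i, P i.
Proof.
move=> h0 h1 h2 [[|[|[|//]]] hi].
- by rewrite (_ : Ordinal hi = i0) //; apply: val_inj.
- by rewrite (_ : Ordinal hi = i1) //; apply: val_inj.
- by rewrite (_ : Ordinal hi = i2) //; apply: val_inj.
Qed.

Definition tup_of (p : X) : tup :=
  [ffun i : 'I_3 => if i == i0 then p.1.1 else if i == i1 then p.1.2 else p.2].
Definition of_tup (x : tup) : X := (x i0, x i1, x i2).

Lemma tup_ofK : cancel tup_of of_tup.
Proof. by move=> [[a b] c]; rewrite /of_tup !ffunE. Qed.

Lemma of_tupK : cancel of_tup tup_of.
Proof. by move=> x; apply/ffunP; apply: ord3P; rewrite ffunE. Qed.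

Lemma of_tup_tmul x y : of_tup (tmul x y) = (of_tup x * of_tup y)%g.
Proof. by rewrite /of_tup !ffunE. Qed.

Definition dens (mu : {ffun tup -> R}) a b c := mu (tup_of (a, b, c)).
Definition tupT (mu : {ffun tup -> R}) := \sum_x mu x *: lact R (of_tup x).

Lemma sum_tup (V : zmodType) (h : tup -> V) :
  \sum_x h x = \sum_a \sum_b \sum_c h (tup_of (a, b, c)).
Proof.
rewrite -(sum_triple (fun p => h (tup_of p))) (reindex tup_of) //.
by exists of_tup => x _; [exact: tup_ofK | exact: of_tupK].
Qed.

Lemma tupTE mu :
  tupT mu = opT (@lact0 R G) (@lact1 R G) (@lact2 R G) (dens mu).
Proof. by rewrite /tupT sum_tup; do 3 (apply: eq_bigr => ? _); rewrite tup_ofK. Qed.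

Lemma tupT_conv mu nu : tupT (conv mu nu) = tupT mu *m tupT nu.
Proof.
have h := L3P (lact0P R G) (lact1P R G) (lact2P R G) (@lact01 R G) (@lact02 R G) (@lact12 R G).
rewrite /tupT mulmx_suml.
under eq_bigr do rewrite ffunE scaler_suml.
rewrite exchange_big; apply: eq_bigr => x _ /=.
under eq_bigr do rewrite scaler_suml.
rewrite exchange_big mulmx_sumr; apply: eq_bigr => y _ /=.
rewrite (bigD1 (tmul x y)) //= eqxx big1 ?addr0 => [|z /negPf hz].
  by rewrite -scalemxAl -scalemxAr scalerA of_tup_tmul [lact R _](orepM h).
by rewrite eq_sym hz scale0r.
Qed.

Local Notation E := (avg3 (@lact0 R G) (@lact1 R G) (@lact2 R G)).

Lemma tupT_avg3 (mu : {ffun tup -> R}) : \sum_x mu x = 1 -> tupT mu *m E = E.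
Proof.
move=> h; rewrite /tupT mulmx_suml.
under eq_bigr do rewrite -scalemxAl lact_avg3.
by rewrite -scaler_suml h scale1r.
Qed.

Lemma avg3_tupT mu : E *m tupT mu = tupT mu *m E.
Proof.
rewrite /tupT mulmx_suml mulmx_sumr; apply: eq_bigr => x _.
by rewrite -scalemxAl -scalemxAr lact_avg3C.
Qed.

Let EP : proj E := proj_avg3 (lact0P R G) (lact1P R G) (lact2P R G)
  (@lact01 R G) (@lact02 R G) (@lact12 R G).
Local Notation Q := (1%:M - E).

(** [Q] is idempotent and commutes with every [tupT nu], so convolving multiplies the operators
    restricted to the complement of the constants. The starting [mu] and its bound [c] are general
    because [foldl] changes its accumulator. *)
Lemma opn_conv_fold kappa mu (s : seq {ffun tup -> R}) c : 0 <= c -> 0 <= kappa ->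
  opn c (tupT mu *m Q) -> tupT mu *m E = E ->
  (forall nu, nu \in s -> opn kappa (tupT nu *m Q) /\ tupT nu *m E = E) ->
  opn (c * kappa ^+ size s) (tupT (foldl (@conv G R 3) mu s) *m Q) /\
  tupT (foldl (@conv G R 3) mu s) *m E = E.
Proof.
move=> + kappa0; elim: s mu c => [|nu s IH] mu c c0 hc hE hs /=.
  by rewrite mulr1.
have [hn1 hn2] := hs nu (mem_head _ _).
rewrite exprS mulrA; apply: IH.
- exact: mulr_ge0.
- have -> : tupT (conv mu nu) *m Q = (tupT mu *m Q) *m (tupT nu *m Q).
    rewrite tupT_conv -!mulmxA; congr (_ *m _).
    have e : Q *m tupT nu = tupT nu *m Q by rewrite mulmxBl mulmxBr mul1mx mulmx1 avg3_tupT.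
    by rewrite mulmxA e -mulmxA (projC EP).1.
  exact: opn_mul.
- by rewrite tupT_conv -mulmxA hn2.
- by move=> nu' h; apply: hs; rewrite inE h orbT.
Qed.

Lemma tupT_entry (mu : {ffun tup -> R}) (x : tup) :
  tupT mu (enum_rank (of_tup x)) (enum_rank (1%g : X)) = mu x.
Proof.
rewrite /tupT summxE (bigD1 x) //= big1 ?addr0 => [|y hy].
  by rewrite mxE lactE mxE !enum_rankK /= !mulg1 eqxx mulr1.
rewrite mxE lactE mxE !enum_rankK /= !mulg1 (_ : (_ == _) = false) ?mulr0 //.
by apply: contraNF hy => /eqP h; rewrite -(of_tupK x) h (of_tupK y).
Qed.

Lemma entry_sqr_le N (A : 'M[R]_N) c i j : opn c A -> A i j ^+ 2 <= c.
Proof.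
move=> h; pose d (k : 'I_N) : 'cV[R]_N := delta_mx k 0.
have nd k : nrm (d k) = 1.
  by rewrite /nrm dotE trmx_delta mul_delta_mx mxE !eqxx.
have e : dot (d i) (A *m d j) = A i j.
  by rewrite dotE trmx_delta mulmxA -rowE -colE !mxE.
rewrite -e; apply: le_trans (dot_sqr_le _ _) _.
by rewrite nd mul1r; apply: le_trans (h _) _; rewrite nd mulr1.
Qed.

(** The column of [tupT mu] at the identity is [mu] itself and that of [E] is uniform, so an
    operator bound yields a pointwise one. *)
Lemma tup_dev mu x c : opn c (tupT mu *m Q) -> tupT mu *m E = E ->
  (mu x - n ^- 3) ^+ 2 <= c.
Proof.
move=> h hE; have := entry_sqr_le (enum_rank (of_tup x)) (enum_rank (1%g : X)) h.
by rewrite mulmxBr mulmx1 hE mxE [(- E) _ _]mxE tupT_entry avg3_entry.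
Qed.

Definition upd (g : tup) k c : tup := [ffun i => if i == k then c else g i].

Lemma marg_del (mu : {ffun tup -> R}) k g :
  marg mu [set~ k] g = \sum_c mu (upd g k c).
Proof.
rewrite /marg (reindex_onto (upd g k) (fun x : tup => x k)) /=.
  apply: eq_bigl => c; rewrite ffunE eqxx eqxx andbT.
  by apply/forall_inP => i; rewrite !inE ffunE => /negPf->.
move=> x /forall_inP h; apply/ffunP => i; rewrite ffunE; case: eqVneq => [->//|ik].
by apply/esym/eqP/h; rewrite !inE.
Qed.

Lemma marg_full (mu : {ffun tup -> R}) (I : {set 'I_3}) g : #|I| = 3%N -> marg mu I g = mu g.
Proof.
move=> hI; have -> : I = setT by apply/eqP; rewrite eqEcard subsetT cardsT card_ord hI.
rewrite /marg (big_pred1 g) // => x; apply/forall_inP/eqP => [h|-> //].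
by apply/ffunP => i; apply/eqP; apply: h; rewrite inE.
Qed.

Lemma good_del eps (mu : {ffun tup -> R}) k g : good eps 2 mu ->
  `|\sum_c mu (upd g k c) - n ^- 2| <= eps / n ^+ 2.
Proof.
move=> h; have hk : #|[set~ k]| = 2%N by rewrite cardsC1 card_ord.
have [h1 h2] := h _ g hk.
by move: h1 h2; rewrite marg_del ler_norml !mulrDl mul1r mulNr => h1 h2; apply/andP; split; lra.
Qed.

End Tuples.

Lemma card_SL2_ge (F : finFieldType) : (#|F| <= #|SL2 F|)%N.
Proof.
apply: leq_card (@sl_upper F) _ => x y /(congr1 (@smat F)); rewrite !sl_upperE.
by move=> /matrixP/(_ 0 1); rewrite !mxE.
Qed.

Lemma good_opn (F : finFieldType) (R : rcfType) (mu : {ffun tupG (SL2 F) 3 -> R}) (beta : R) :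
  is_prob_dist mu -> good (Num.sqrt (#|SL2 F|%:R))^-1 2 mu ->
  0 <= beta -> beta ^+ 8 = 2 ^+ 23 / #|F|%:R ->
  opn (16 * beta) (tupT mu *m (1%:M - avg3 (@lact0 R (SL2 F)) (@lact1 R _) (@lact2 R _))).
Proof.
move=> [mu0 mu1] hg b0 bE; rewrite tupTE.
apply: (opn_T (eps := (Num.sqrt #|SL2 F|%:R)^-1) (lact0P R _) (lact1P R _) (lact2P R _)
  (ract0P R _) (ract1P R _) (ract2P R _) (@lact01 R _) (@lact02 R _) (@lact12 R _)
  (@ract01 R _) (@ract02 R _) (@ract12 R _) (@rl0 R _) (@rl1 R _) (@rl2 R _)
  (avg_reg0 R _) (avg_reg1 R _) (avg_reg2 R _) (@tr_lact R _) _ _) => //.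
- by move=> a b c; exact: mu0.
- by rewrite -mu1 sum_tup.
- move=> a b; have := good_del i2 (tup_of (a, b, 1%g)) hg.
  congr (`|_ - _| <= _); apply: eq_bigr => c _; congr (mu _).
  by apply/ffunP; apply: ord3P; rewrite !ffunE.
- move=> a c; have := good_del i1 (tup_of (a, 1%g, c)) hg.
  congr (`|_ - _| <= _); apply: eq_bigr => b _; congr (mu _).
  by apply/ffunP; apply: ord3P; rewrite !ffunE.
- move=> b c; have := good_del i0 (tup_of (1%g, b, c)) hg.
  congr (`|_ - _| <= _); apply: eq_bigr => a _; congr (mu _).
  by apply/ffunP; apply: ord3P; rewrite !ffunE.
(* The square of [eps] is 1 / n, at most 1 / q because SL(2,q) contains the upper unipotents. *)
rewrite exprVn sqr_sqrtr ?ler0n // lef_pV2 ?posrE ?ltr0n //.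
- by rewrite ler_nat card_SL2_ge.
- by apply/card_gt0P; exists 1%g.
- by apply/card_gt0P; exists 0.
Qed.

Lemma conv_seq_dev (F : finFieldType) (R : rcfType) (mus : seq {ffun tupG (SL2 F) 3 -> R})
    (beta : R) g : (0 < size mus)%N ->
  (forall mu, mu \in mus ->
     is_prob_dist mu /\ good (Num.sqrt (#|SL2 F|%:R))^-1 2 mu) ->
  0 <= beta -> beta ^+ 8 = 2 ^+ 23 / #|F|%:R ->
  (conv_seq mus g - #|SL2 F|%:R ^- 3) ^+ 2 <= (16 * beta) ^+ size mus.
Proof.
case: mus => [//|mu s] _ h b0 bE.
have k0 : 0 <= 16 * beta by rewrite mulr_ge0.
have hT nu : nu \in mu :: s ->
    opn (16 * beta) (tupT nu *m (1%:M - avg3 (@lact0 R (SL2 F)) (@lact1 R _) (@lact2 R _))) /\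
    tupT nu *m avg3 (@lact0 R (SL2 F)) (@lact1 R _) (@lact2 R _) =
      avg3 (@lact0 R (SL2 F)) (@lact1 R _) (@lact2 R _).
  move=> /h [hp hg]; split; first exact: good_opn.
  by apply: tupT_avg3; exact: hp.2.
have [m1 m2] := hT mu (mem_head _ _).
have [|c1 c2] := opn_conv_fold k0 k0 m1 m2 (s := s).
  by move=> nu hn; apply: hT; rewrite inE hn orbT.
by have := tup_dev g c1 c2; rewrite -exprS.
Qed.

(** * Choice of the constants *)

Lemma beta_pow_le (R : rcfType) (q n beta : R) : 0 < n -> n <= q ^+ 3 -> 0 < q ->
  2 ^+ 110 <= q -> 0 <= beta -> beta ^+ 8 = 2 ^+ 23 / q ->
  (16 * beta) ^+ (8 * 60) <= (n ^- 2 / n ^+ 3) ^+ 2.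
Proof.
move=> n0 nq q0 qb b0 bE.
rewrite exprM [(16 * beta) ^+ 8]exprMn bE.
(* 16^8 2^23 = 2^(32 + 23), so eight factors contribute 2^55 / q. After sixty rounds the constant is
   2^3300 = (2^110)^30, at most q^30. There remains q^-30, which is at most n^-10, the square of the
   permitted deviation. *)
have -> : 16 ^+ 8 * (2 ^+ 23 / q) = 2 ^+ 55 / q.
  rewrite mulrA (_ : 16 = 2 ^+ 4 :> R); last by rewrite -natrX.
  by rewrite -exprM -exprD.
have -> : (n ^- 2 / n ^+ 3) ^+ 2 = n ^- 10.
  by rewrite -invrM ?unitfE ?expf_neq0 ?lt0r_neq0 // -exprD exprVn -exprM.
rewrite exprMn exprVn.
apply: le_trans (_ : q ^+ 30 / q ^+ 60 <= _).
  rewrite ler_wpM2r ?invr_ge0 ?exprn_ge0 ?(ltW q0) //.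
  rewrite -exprM (exprM 2 110 30 : 2 ^+ (55 * 60) = _).
  by rewrite lerXn2r ?nnegrE ?exprn_ge0 // ltW.
rewrite (exprD q 30 30) invrM ?unitfE ?expf_neq0 ?lt0r_neq0 // mulrA mulfV ?mul1r ?expf_neq0 ?lt0r_neq0 //.
rewrite lef_pV2 ?posrE ?exprn_gt0 // (exprM q 3 10).
by rewrite lerXn2r ?nnegrE ?exprn_ge0 // ltW.
Qed.

Theorem mainTheorem12 :
  exists (d : nat) (n0 : nat), (2 <= d)%N /\
  forall (F : finFieldType) (R : rcfType),
    let n := #|SL2 F| in
    (n0 <= n)%N ->
    forall mus : seq {ffun tupG (SL2 F) 3 -> R},
      size mus = d ->
      (forall mu, mu \in mus ->
         is_prob_dist mu /\ good (Num.sqrt (n%:R))^-1 2 mu) ->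
      good (n%:R ^+ 2)^-1 3 (conv_seq mus).
Proof.
(* Since n is at most q^3, a lower bound on n forces one on q. The existential keeps the numeral
   (2^110)^3 abstract afterwards. *)
have [n0 hn0] : exists n0 : nat, forall F : finFieldType, (n0 <= #|SL2 F|)%N ->
    (2 ^ 110 <= #|F|)%N.
  exists ((2 ^ 110) ^ 3)%N => F h.
  by rewrite -(leq_exp2r _ _ (isT : 0 < 3)%N); apply: leq_trans h (card_SL2_le F).
exists (8 * 60)%N, n0; split=> // F R n hn mus hs h I g hI.
rewrite marg_full //.
have q0 : 0 < #|F|%:R :> R by rewrite ltr0n; apply/card_gt0P; exists 0.
have npos : 0 < n%:R :> R by rewrite ltr0n; apply/card_gt0P; exists 1%g.
pose beta : R := Num.sqrt (Num.sqrt (Num.sqrt (2 ^+ 23 / #|F|%:R))).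
have b0 : 0 <= beta by exact: sqrtr_ge0.
have bE : beta ^+ 8 = 2 ^+ 23 / #|F|%:R.
  rewrite (exprM _ 2 4) sqr_sqrtr ?sqrtr_ge0 // (exprM _ 2 2) sqr_sqrtr ?sqrtr_ge0 //.
  by rewrite sqr_sqrtr // divr_ge0 // ?exprn_ge0 // ltW.
have dev := conv_seq_dev g (_ : 0 < size mus)%N h b0 bE.
rewrite hs in dev; have {}dev := dev isT.
have nq : n%:R <= #|F|%:R ^+ 3 :> R by rewrite -natrX ler_nat; exact: card_SL2_le.
have qb : 2 ^+ 110 <= #|F|%:R :> R by rewrite -natrX ler_nat; exact: hn0.
have {}dev := le_trans dev (beta_pow_le npos nq q0 qb b0 bE).
have p0 : 0 <= (n%:R ^- 2 / n%:R ^+ 3 : R).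
  by rewrite divr_ge0 ?invr_ge0 ?exprn_ge0 ?(ltW npos).
have : `|conv_seq mus g - n%:R ^- 3| <= n%:R ^- 2 / n%:R ^+ 3.
  by rewrite -(@ler_pXn2r _ 2) ?nnegrE // real_normK ?num_real.
rewrite ler_norml mulrBl mulrDl mul1r => /andP[h1 h2].
by split; lra.
Qed.
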